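(* Let $(\mathfrak n,g)$ be an irreducible $2$-step nilpotent metric Lie algebra, $\mathfrak n=\mathfrak v\oplus\mathfrak z$. Let $S\in \mathrm{Sym}^2\mathfrak v$ define a left-invariant symmetric Killing tensor on $N$. Denote by $\lambda_1,\ldots,\lambda_k$ the (distinct) eigenvalues of $S$ viewed as an endomorphism of $\mathfrak v$, and by $\mathfrak v_1,\ldots,\mathfrak v_k$ the corresponding eigenspaces. For $a\in\mathbb R$ and $z\in\mathfrak z$ let $$T_z^{\boldsymbol\lambda-a}:=j(z)\circ\sum_{i=1}^k(\lambda_i-a)\,\mathrm{pr}_{\mathfrak v_i}:\mathfrak v\to\mathfrak v,$$ where $\mathrm{pr}_{\mathfrak v_i}:\mathfrak v\to\mathfrak v$ is the orthogonal projection onto $\mathfrak v_i$. Then $S$ is decomposable if and only if there exists $a\in\mathbb R$ such that for every $z\in\mathfrak z$ the endomorphism $T^{\boldsymbol\lambda-a}_z$ of $\mathfrak v$ extends to a skew-symmetric derivation of $\mathfrak n$.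
   Context: $\mathfrak n$ is a finite-dimensional real $2$-step nilpotent Lie algebra (non-abelian, with $[[\mathfrak n,\mathfrak n],\mathfrak n]=0$) with an inner product $g$; $N$ is the connected and simply connected Lie group with Lie algebra $\mathfrak n$, endowed with the left-invariant Riemannian metric (also denoted $g$) defined by $g$; $\nabla$ is its Levi-Civita connection. $\mathfrak z$ is the center of $\mathfrak n$ and $\mathfrak v=\mathfrak z^\perp$. $(\mathfrak n,g)$ is irreducible if it cannot be written as an orthogonal direct sum of two non-zero ideals. For $z\in\mathfrak z$, $j(z)\in\mathfrak{so}(\mathfrak v)$ is defined by $g(j(z)x,y)=g(z,[x,y])$ for all $x,y\in\mathfrak v$. A skew-symmetric derivation of $\mathfrak n$ is a derivation $D$ of $\mathfrak n$ that is skew-symmetric with respect to $g$. Elements of $\mathrm{Sym}^2\mathfrak n$ are identified with $g$-symmetric endomorphisms of $\mathfrak n$ (via $S(x,y)=g(Sx,y)$), and with left-invariant symmetric $2$-tensor fields on $N$. $\mathrm{Sym}^2\mathfrak v\subset\mathrm{Sym}^2\mathfrak n$ consists of those endomorphisms that preserve $\mathfrak v$ and vanish on $\mathfrak z$. A symmetric $2$-tensor field $S$ is a Killing tensor if $(\nabla_XS)(X,X)=0$ for every vector field $X$. A left-invariant symmetric Killing $2$-tensor on $N$ is called decomposable if it is the sum of a parallel symmetric $2$-tensor field and a (real, finite) linear combination of symmetric products $\xi\cdot\eta=\xi\otimes\eta+\eta\otimes\xi$ of Killing vector fields $\xi,\eta$ on $(N,g)$ (not necessarily left-invariant; vectors are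 identified with covectors via $g$). *)

(* Defs.v *)
From HB Require Import structures.
From mathcomp Require Import all_boot all_order all_algebra.
From mathcomp Require Import all_classical all_reals all_analysis.

Set Implicit Arguments.
Unset Strict Implicit.
Unset Printing Implicit Defensive.

Import Order.TTheory GRing.Theory Num.Theory numFieldNormedType.Exports.

Local Open Scope classical_set_scope.
Local Open Scope ring_scope.

Section Smooth.
Context {R : realType} {V W : normedModType R}.

Fixpoint Cn (n : nat) (f : V -> W) : Prop :=
  if n is n'.+1 then
    (forall p, differentiable f p) /\ (forall v, Cn n' (fun p => 'D_v f p))
  else continuous f.

Definition smooth (f : V -> W) : Prop := forall n, Cn n f.

End Smooth.

(* Riemannian geometry of a manifold with one global chart, the vector space
   V. All tangent spaces are identified with V by the chart, so a vector field
   is a map V -> V and a covariant 2-tensor field T is written T p u v. *)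
Section GlobalChart.
Context {R : realType} {V : normedModType R}.
Implicit Types (X Y Z xi eta : V -> V) (f : V -> R) (T metric : V -> V -> V -> R).
Implicit Type nabla : (V -> V) -> (V -> V) -> V -> V.

(* the function X f *)
Definition dir (X : V -> V) (f : V -> R) : V -> R := fun p => 'D_(X p) f p.

(* the commutator of vector fields, with [X, Y] f = X (Y f) - Y (X f) *)
Definition vf_bracket (X Y : V -> V) : V -> V :=
  fun p => 'D_(X p) Y p - 'D_(Y p) X p.

Record sym2_field T : Prop := Sym2Field {
  sym2_linear : forall p u, scalar (T p u);
  sym2_sym : forall p u v, T p u v = T p v u;
  sym2_smooth : forall u v, smooth (fun p => T p u v)
}.

Record levi_civita metric nabla : Prop := LeviCivita {
  lc_smooth : forall X Y, smooth X -> smooth Y -> smooth (nabla X Y);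
  lc_addl : forall X Y Z, smooth X -> smooth Y -> smooth Z ->
    forall p, nabla (fun q => X q + Y q) Z p = nabla X Z p + nabla Y Z p;
  lc_scalel : forall f X Y, smooth f -> smooth X -> smooth Y ->
    forall p, nabla (fun q => f q *: X q) Y p = f p *: nabla X Y p;
  lc_addr : forall X Y Z, smooth X -> smooth Y -> smooth Z ->
    forall p, nabla X (fun q => Y q + Z q) p = nabla X Y p + nabla X Z p;
  lc_leibniz : forall f X Y, smooth f -> smooth X -> smooth Y ->
    forall p, nabla X (fun q => f q *: Y q) p
              = dir X f p *: Y p + f p *: nabla X Y p;
  lc_torsion : forall X Y, smooth X -> smooth Y ->
    forall p, nabla X Y p - nabla Y X p = vf_bracket X Y p;
  lc_metric : forall X Y Z, smooth X -> smooth Y -> smooth Z ->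
    forall p, dir X (fun q => metric q (Y q) (Z q)) p
              = metric p (nabla X Y p) (Z p) + metric p (Y p) (nabla X Z p)
}.

(* (nabla_X T)(Y, Z) *)
Definition cov_deriv nabla T X Y Z : V -> R := fun p =>
  dir X (fun q => T q (Y q) (Z q)) p
  - T p (nabla X Y p) (Z p) - T p (Y p) (nabla X Z p).

Definition parallel nabla T : Prop :=
  forall X Y Z, smooth X -> smooth Y -> smooth Z ->
  forall p, cov_deriv nabla T X Y Z p = 0.

Definition killing_tensor nabla T : Prop :=
  forall X, smooth X -> forall p, cov_deriv nabla T X X X p = 0.

(* the Lie derivative of the metric along xi vanishes *)
Definition killing_field metric xi : Prop :=
  smooth xi /\ forall X Y, smooth X -> smooth Y ->
  forall p, dir xi (fun q => metric q (X q) (Y q)) p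
            - metric p (vf_bracket xi X p) (Y p)
            - metric p (X p) (vf_bracket xi Y p) = 0.

Definition sym_prod metric xi eta : V -> V -> V -> R := fun p u v =>
  metric p (xi p) u * metric p (eta p) v
  + metric p (eta p) u * metric p (xi p) v.

Definition decomposable metric nabla T : Prop :=
  exists P : V -> V -> V -> R,
  exists r : nat, exists c : 'I_r -> R, exists xi eta : 'I_r -> V -> V,
  [/\ sym2_field P,
      parallel nabla P,
      forall i, killing_field metric (xi i) /\ killing_field metric (eta i)
    & forall p u v,
        T p u v = P p u v + \sum_(i < r) c i * sym_prod metric (xi i) (eta i) p u v].

End GlobalChart.

Section MetricLieAlgebra.
Context {R : realType} {m : nat}.
Local Notation V := 'rV[R]_m.
Implicit Types (br : {bilinear V -> V -> V}) (g : {dot V for @idfun R}).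

Record two_step_nilpotent br : Prop := TwoStepNilpotent {
  br_alt : forall x, br x x = 0;
  br_jacobi : forall x y z, br x (br y z) + br y (br z x) + br z (br x y) = 0;
  br_two_step : forall x y z, br (br x y) z = 0;
  br_nonabelian : exists x y, br x y <> 0
}.

Definition lie_ideal br (I : {vspace V}) : Prop :=
  forall x y, x \in I -> br x y \in I.

Definition irreducible_lie br g : Prop :=
  ~ exists I J : {vspace V},
      [/\ lie_ideal br I /\ lie_ideal br J, I != 0%VS /\ J != 0%VS,
          (I <= orthov g J)%VS & (I + J)%VS = fullv].

Definition lie_center br : {vspace V} :=
  (\bigcap_(i < m) lker (linfun (br (delta_mx 0%R i))))%VS.

Definition vpart br g : {vspace V} := orthov g (lie_center br).

(* j(z) x is the vector of v given by Riesz representation; on the centre,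
   which is outside the domain v of j(z), this yields 0 *)
Definition jmap br g (z x : V) : V :=
  xget 0 [set w | w \in vpart br g /\
                  {in vpart br g, forall y, g w y = g z (br x y)}].

Definition skew_derivation br g (D : 'End(V)) : Prop :=
  (forall x y, D (br x y) = br (D x) y + br x (D y)) /\
  (forall x y, g (D x) y = - g x (D y)).

Definition in_Sym2v br g (S : 'End(V)) : Prop :=
  [/\ forall x y, g (S x) y = g x (S y),
      (S @: vpart br g <= vpart br g)%VS
    & (lie_center br <= lker S)%VS].

(* the intersection matters only for the eigenvalue 0, since S kills z *)
Definition eigenspace_v br g (S : 'End(V)) (l : R) : {vspace V} :=
  (passmx.leigenspace S l :&: vpart br g)%VS.

Definition eigenvalues_v br g (S : 'End(V)) : set R :=
  [set l | eigenspace_v br g S l != 0%VS].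

Definition orth_proj g (W : {vspace V}) : 'End(V) := daddv_pi W (orthov g W).

Definition Tmap br g (S : 'End(V)) (k : nat) (lambda : 'I_k -> R)
    (a : R) (z : V) : V -> V := fun x =>
  jmap br g z
    (\sum_(i < k) (lambda i - a) *: orth_proj g (eigenspace_v br g S (lambda i)) x).

Definition extends_to_skew_derivation br g (f : V -> V) : Prop :=
  exists D : 'End(V),
    skew_derivation br g D /\ {in vpart br g, forall x, D x = f x}.

(* The simply connected group N, in the global chart exp : n -> N: by the
   Baker-Campbell-Hausdorff formula it is n with the product gmul, which is
   associative by gmulA. The neutral element is 0 and the inverse of p is - p. *)
Definition gmul br (p q : V) : V := p + q + 2^-1 *: br p q.

(* the differential at p of left translation by the inverse of p,
   from T_p N to T_e N = n *)
Definition left_triv br (p u : V) : V := 'D_u (gmul br (- p)) p.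

Definition left_inv br (h : V -> V -> R) : V -> V -> V -> R :=
  fun p u v => h (left_triv br p u) (left_triv br p v).

Definition left_metric br g : V -> V -> V -> R := left_inv br g.

Definition left_tensor br g (S : 'End(V)) : V -> V -> V -> R :=
  left_inv br (fun x y => g (S x) y).

Lemma bracketC br : two_step_nilpotent br -> forall x y, br x y = - br y x.
Proof.
move=> nbr x y; apply/eqP; rewrite -addr_eq0.
have := br_alt nbr (x + y); rewrite linearDl/= !linearDr/= !(br_alt nbr).
by rewrite add0r addr0 => ->.
Qed.

Lemma lie_centerP br (z : V) : two_step_nilpotent br ->
  (z \in lie_center br) <-> (forall x, br z x = 0).
Proof.
move=> nbr; rewrite /lie_center memvE; split.
  move=> /subv_bigcapP zc x; rewrite bracketC// (row_sum_delta x).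
  rewrite linear_sumlz/= big1 ?oppr0// => i _.
  rewrite linearZl_LR/=; have := zc i isT; rewrite -memvE memv_ker lfunE/=.
  by move=> /eqP ->; rewrite scaler0.
move=> zc; apply/subv_bigcapP => i _.
by rewrite -memvE memv_ker lfunE/= bracketC// zc oppr0.
Qed.

Lemma gmulA br : two_step_nilpotent br -> associative (gmul br).
Proof.
move=> nbr x y z; rewrite /gmul.
rewrite !linearDl/= !linearDr/= !linearZl_LR/= !linearZr_LR/=.
rewrite (bracketC nbr x (br y z)) !(br_two_step nbr) oppr0 !scaler0 !addr0.
rewrite !scalerDr -!addrA; do 2 congr (_ + _).
by rewrite [RHS]addrCA; congr (_ + _); rewrite addrC -addrA.
Qed.

Lemma left_trivE br : two_step_nilpotent br ->
  forall p u, left_triv br p u = u - 2^-1 *: br p u.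
Proof.
move=> nbr p u; rewrite /left_triv.
have E h : gmul br (- p) (h *: u + p) = h *: (u - 2^-1 *: br p u).
  rewrite /gmul linearNl/= linearDr/= (br_alt nbr) addr0 linearZr_LR/=.
  by rewrite addrCA addNr addr0 scalerBr scalerN !scalerA mulrC.
have E0 : gmul br (- p) p = 0.
  by have := E 0; rewrite !scale0r add0r.
rewrite /derive; apply: cvg_lim => //; apply: cvg_near_cst.
near=> h; rewrite /= E E0 subr0 scalerA mulVf ?scale1r//.
near: h; exact: nbhs_dnbhs_neq.
Unshelve. all: by end_near.
Qed.

End MetricLieAlgebra.

(* Main.v *)
From HB Require Import structures.
Require Import Defs.
From mathcomp Require Import all_boot all_order all_algebra.
From mathcomp Require Import all_classical all_reals all_analysis.
From mathcomp Require Import ring lra.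
Import Order.TTheory GRing.Theory Num.Theory numFieldNormedType.Exports.
Local Open Scope classical_set_scope.
Local Open Scope ring_scope.

(* In the left trivialization a Killing field xi is a function F : n -> n, and
   its Lie derivative on left-invariant fields is a field of skew endomorphisms
   B.  Commuting two derivatives of B shows that B preserves the curvature,
   hence the Ricci form, which is negative definite on v, nonnegative on z and
   has v and z orthogonal.  So B preserves v and z, and the Jacobi identity
   for xi and two fields of v then says that B is a derivation of n.  The same
   Ricci argument makes a parallel symmetric tensor preserve v and z; being
   parallel it then commutes with the bracket, its eigenspaces are ideals, and
   irreducibility leaves only multiples of the metric.

   If S = a g + sum c (xi . eta), the derivative of this identity at the
   neutral element, evaluated on v and z, exhibits j(z) (S - a) as a
   combination of the derivations B of the fields xi and eta.  Conversely, if
   D_z is a skew derivation extending j(z) (S - a), then with an orthonormal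
   basis e_i, the right-invariant fields X_u and the fields p |-> D_z p,
     S - a g = 1/2 sum_i X_(e_i) . X_((S - a) e_i)
               + sum_i X_(pr e_i) . D_(pr e_i)
   where pr is the projection onto z. *)

(** The Killing fields in a decomposition are arbitrary, so no normal form for them can be assumed.
    What replaces it is Koszul's trick: since B is skew and the Jacobi identity fixes the
    antisymmetric part of its derivative, that derivative is an algebraic expression in B. Thus B
    solves a closed linear first-order system, and invariance of the curvature is its integrability
    condition. The decomposition is differentiated on a pair from v and z because there the unknown
    terms die: brackets are orthogonal to v, and B maps v into v. Only B paired with v survives,
    weighted by the constants g(xi(0), z) and g(eta(0), z), so a constant combination of skew
    derivations remains. In the converse, the factor 1/2 compensates for the symmetric product
    counting each pair twice, and the first sum is S - a at the neutral element only. The fields D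
    vanish there and cancel the dependence on p elsewhere. The terms containing the central part of
    p cancel because D_u w is antisymmetric in central u and w; this is where irreducibility enters,
    as injectivity of j on z. *)

Set Implicit Arguments.
Unset Strict Implicit.
Unset Printing Implicit Defensive.

(** * Inner products, frames and traces *)

Section InnerProduct.
Context {R : realType} {m : nat}.
Local Notation V := 'rV[R]_m.
Context (g : {dot V for @idfun R}).

Lemma dotC x y : g x y = g y x.
Proof. by rewrite hermC/= expr0 mul1r. Qed.

Lemma dotDl x y z : g (x + y) z = g x z + g y z.
Proof. exact: linearDl. Qed.

Lemma dotDr x y z : g z (x + y) = g z x + g z y.
Proof. exact: linearDr. Qed.

Lemma dotZl a x z : g (a *: x) z = a * g x z.
Proof. exact: linearZl_LR. Qed.

Lemma dotZr a x z : g z (a *: x) = a * g z x.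
Proof. exact: linearZr_LR. Qed.

Lemma dotNl x z : g (- x) z = - g x z.
Proof. exact: linearNl. Qed.

Lemma dotNr x z : g z (- x) = - g z x.
Proof. exact: linearNr. Qed.

Lemma dot0l z : g 0 z = 0.
Proof. exact: linear0l. Qed.

Lemma dot0r z : g z 0 = 0.
Proof. exact: linear0r. Qed.

Lemma dot_suml I (r : seq I) (P : pred I) F z :
  g (\sum_(i <- r | P i) F i) z = \sum_(i <- r | P i) g (F i) z.
Proof. exact: linear_sumlz. Qed.

Lemma dot_sumr I (r : seq I) (P : pred I) F z :
  g z (\sum_(i <- r | P i) F i) = \sum_(i <- r | P i) g z (F i).
Proof. exact: linear_sumr. Qed.

Definition dotE := (dotDl, dotDr, dotZl, dotZr, dotNl, dotNr, dot0l, dot0r).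

Lemma dot_gt0 x : x != 0 -> 0 < g x x.
Proof. exact: neq0_dnorm_gt0. Qed.

Lemma dot_ge0 x : 0 <= g x x.
Proof.
by have [->|/dot_gt0/ltW//] := eqVneq x 0; rewrite dot0l.
Qed.

Lemma dot_eq0 x : g x x = 0 -> x = 0.
Proof.
by have [//|/dot_gt0 + E] := eqVneq x 0; rewrite E ltxx.
Qed.

Lemma dot_inj x y : (forall w, g x w = g y w) -> x = y.
Proof.
move=> E; apply/eqP; rewrite -subr_eq0; apply/eqP/dot_eq0.
by rewrite dotDl dotNl E subrr.
Qed.

Lemma orthov_mem (W : {vspace V}) x :
  (forall w, w \in W -> g x w = 0) -> x \in orthov g W.
Proof. by move=> H; apply/mem_orthovP. Qed.

Lemma orthov_dotl (W : {vspace V}) x w :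
  x \in orthov g W -> w \in W -> g x w = 0.
Proof. by move=> /mem_orthovP H /H. Qed.

Lemma orthov_dotr (W : {vspace V}) x w :
  x \in W -> w \in orthov g W -> g x w = 0.
Proof. by move=> xW wW; rewrite dotC (orthov_dotl wW xW). Qed.

Lemma mem_orthov_line u v : (u \in orthov g <[v]>) = (g u v == 0).
Proof. exact: mem_orthov1. Qed.

(* A Parseval frame is all that traces require, so orthonormality is not
   recorded. *)
Definition frame n (W : {vspace V}) (e : 'I_n -> V) : Prop :=
  (forall i, e i \in W) /\
  (forall x, x \in W -> x = \sum_i g x (e i) *: e i).

Lemma frame_exists (W : {vspace V}) : exists n (e : 'I_n -> V), frame W e.
Proof.
have [k] := ubnP (\dim W); elim: k W => // k IH W; rewrite ltnS => Wk.
have [->|W0] := eqVneq W 0%VS.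
  exists 0, (fun=> 0); split=> [[]//|x].
  by rewrite memv0 big_ord0 => /eqP.
set x := vpick W; have xW : x \in W by apply: memv_pick.
have x0 : x != 0 by rewrite vpick0.
have gx0 := dot_gt0 x0.
pose y := (Num.sqrt (g x x))^-1 *: x.
have yy : g y y = 1.
  rewrite /y !dotE mulrA -invfM -expr2 sqr_sqrtr ?ltW// mulVf//.
  by rewrite gt_eqF.
have yW : y \in W by rewrite memvZ.
clearbody y.
have dW : (\dim (W :&: orthov g <[y]>) < k)%N.
  rewrite -eq_dim_orthov1; last first.
    by apply/mem_orthovPn; exists y => //; rewrite -[X in X == _]/(g y y) yy oner_eq0.
  by rewrite prednK// lt0n dimv_eq0.
have [n [e [eW ex]]] := IH _ dW.
exists n.+1, (fun i => oapp e y (unlift ord0 i)); split=> [i|u uW].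
  case: unliftP => [j|] _ //=.
  by have := eW j; rewrite memv_cap => /andP[].
rewrite big_ord_recl unlift_none /=.
under eq_bigr => i _ do rewrite liftK /=.
have ye i : g y (e i) = 0.
  have := eW i; rewrite memv_cap => /andP[_].
  by rewrite mem_orthov_line dotC => /eqP.
have : u - g u y *: y \in (W :&: orthov g <[y]>)%VS.
  rewrite memv_cap rpredB ?rpredZ//= mem_orthov_line !dotE yy mulr1 subrr eqxx//.
move=> /ex E; rewrite -[LHS](subrKC (g u y *: y)); congr (_ + _).
rewrite [LHS]E.
by apply: eq_bigr => i _; rewrite !dotE ye mulr0 subr0.
Qed.

Lemma orthov_cap (W : {vspace V}) : (W :&: orthov g W)%VS = 0%VS.
Proof.
apply/eqP; rewrite -subv0; apply/subvP => x.
by rewrite memv_cap memv0 => /andP[xW /orthov_dotl/(_ xW)/dot_eq0 ->].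
Qed.

Lemma orthov_add (W : {vspace V}) : (W + orthov g W)%VS = fullv.
Proof.
apply/eqP; rewrite eqEsubv subvf; apply/subvP => x _.
have [n [e [eW ex]]] := frame_exists W.
apply/memv_addP; exists (\sum_i g x (e i) *: e i).
  by apply: rpred_sum => i _; rewrite rpredZ// eW.
exists (x - \sum_i g x (e i) *: e i); last by rewrite subrKC.
apply: orthov_mem => w /ex ->; rewrite dot_sumr big1// => i _.
rewrite dotZr dotDl dotNl dot_suml [X in X - _](_ : _ = \sum_j g x (e j) * g (e j) (e i)).
  by under [X in _ - X]eq_bigr do rewrite dotZl; rewrite subrr mulr0.
rewrite dotC [X in g X _](ex _ (eW i)) dot_suml.
by apply: eq_bigr => j _; rewrite dotZl mulrC (dotC (e j) x) (dotC (e i)).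
Qed.

Lemma orth_proj_mem (W : {vspace V}) x : orth_proj g W x \in W.
Proof. exact: memv_pi. Qed.

Lemma orth_projE (W : {vspace V}) x u :
  u \in W -> x - u \in orthov g W -> orth_proj g W x = u.
Proof.
move=> uW xu; rewrite /orth_proj -[in LHS](subrKC u x) linearD /=.
rewrite daddv_pi_id ?orthov_cap// [X in _ + X](_ : _ = 0) ?addr0//.
have := @daddv_pi_add _ _ W (orthov g W) (x - u) (orthov_cap W).
rewrite orthov_add memvf => /(_ isT).
rewrite [X in _ + X]daddv_pi_id 1?capvC ?orthov_cap//.
by move/(canRL (addrK _)); rewrite subrr.
Qed.

Lemma orth_proj_compl (W : {vspace V}) x : x - orth_proj g W x \in orthov g W.
Proof.
have : x \in (W + orthov g W)%VS by rewrite orthov_add memvf.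
move=> /memv_addP[u uW [w wW E]].
by rewrite (@orth_projE _ _ u)// E [u + w]addrC addrK.
Qed.

Lemma orth_proj_adj (W : {vspace V}) x y :
  g (orth_proj g W x) y = g x (orth_proj g W y).
Proof.
have H u v : g (orth_proj g W u) v = g (orth_proj g W u) (orth_proj g W v).
  rewrite -[in LHS](subrKC (orth_proj g W v) v) dotDr.
  by rewrite (orthov_dotr (orth_proj_mem _ _) (orth_proj_compl _ _)) addr0.
by rewrite H [RHS]dotC [RHS]H dotC.
Qed.

Section Trace.
Context (n : nat) (e : 'I_n -> V).
Hypothesis eP : frame fullv e.

Lemma frame_sum x : x = \sum_i g x (e i) *: e i.
Proof. by apply: eP.2; rewrite memvf. Qed.

Lemma frame_scalar (f : V -> R) x : scalar f -> f x = \sum_i g x (e i) * f (e i).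
Proof.
move=> lf; rewrite [in LHS](frame_sum x).
have f0 : f 0 = 0.
  by have := lf (-1) 0 0; rewrite scaler0 addr0 mulN1r addNr.
apply: (big_rec2 (fun u r => f u = r)) => // i a b _ <-.
exact: lf.
Qed.

Lemma frame_norm x : g x x = \sum_i g x (e i) ^+ 2.
Proof.
rewrite {2}(frame_sum x) dot_sumr.
by apply: eq_bigr => i _; rewrite dotZr expr2.
Qed.

Lemma trace_mulC (A B : V -> V) : linear A -> linear B ->
  \sum_i g (A (B (e i))) (e i) = \sum_i g (B (A (e i))) (e i).
Proof.
have E (C D : V -> V) : linear C ->
    \sum_i g (C (D (e i))) (e i) =
    \sum_i \sum_j g (D (e i)) (e j) * g (C (e j)) (e i).
  move=> lC; apply: eq_bigr => i _.
  apply: (@frame_scalar (fun x => g (C x) (e i))).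
  by move=> a u v; rewrite lC !dotE.
move=> lA lB; rewrite (E A)// (E B)// exchange_big/=.
by apply: eq_bigr => i _; apply: eq_bigr => j _; rewrite mulrC.
Qed.

(** Moves an operator to its [g]-adjoint across a form [h] that need not be related to [g], such as
    a Ricci or curvature form. *)
Lemma trace_adj (h : V -> V -> R) (b b' : V -> V) :
  (forall w, scalar (h^~ w)) -> (forall u, scalar (h u)) ->
  (forall x y, g (b x) y = g x (b' y)) ->
  \sum_i h (b (e i)) (e i) = \sum_i h (e i) (b' (e i)).
Proof.
move=> hl hr bb'; under eq_bigr do rewrite (frame_scalar _ (hl _)).
under [RHS]eq_bigr => i _ do rewrite (frame_scalar _ (hr _)).
rewrite exchange_big/=; apply: eq_bigr => i _; apply: eq_bigr => j _.
by rewrite bb' dotC.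
Qed.

End Trace.
End InnerProduct.

(** * Connection and Ricci form of a metric 2-step Lie algebra *)

Section ChosenFrame.
Context {R : realType} {m : nat}.
Local Notation V := 'rV[R]_m.
Context (g : {dot V for @idfun R}).

Definition fdim : nat := projT1 (cid (frame_exists g fullv)).
Definition fvec : 'I_fdim -> V :=
  projT1 (cid (projT2 (cid (frame_exists g fullv)))).

Lemma fvecP : frame g fullv fvec.
Proof. exact: projT2 (cid (projT2 (cid (frame_exists g fullv)))). Qed.

End ChosenFrame.
Arguments fvec {R m} g.

Section MetricBracket.
Context {R : realType} {m : nat}.
Local Notation V := 'rV[R]_m.
Context (br : {bilinear V -> V -> V}) (g : {dot V for @idfun R}).
Local Notation e := (fvec g).

(* [adj z x] is the extension of j(z)x to all z and x in the Lie algebra. *)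
(* Locking keeps rewriting with the linearity of [g] from unfolding the sums. *)
Fact lock_key : unit. Proof. exact: tt. Qed.
Definition adj : V -> V -> V := locked_with lock_key
  (fun z x => \sum_i g z (br x (e i)) *: e i).

Lemma adj_is_bilinear : bilinear_for
  (GRing.Scale.Law.clone _ _ *:%R _) (GRing.Scale.Law.clone _ _ *:%R _) adj.
Proof.
split=> [x|z] a u v /=; rewrite /adj unlock scaler_sumr -big_split/=;
  apply: eq_bigr => i _.
  by rewrite !dotE scalerDl scalerA.
by rewrite linearPl /= !dotE scalerDl scalerA.
Qed.

HB.instance Definition _ :=
  bilinear_isBilinear.Build R V V V _ _ adj adj_is_bilinear.

Lemma adjE z x y : g (adj z x) y = g z (br x y).
Proof.
rewrite /adj unlock dot_suml (@frame_scalar _ _ g _ _ (fvecP g) (fun y => g z (br x y))).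
  by apply: eq_bigr => i _; rewrite dotZl mulrC dotC.
by move=> a u v; rewrite linearPr /= !dotE.
Qed.

(* the Levi-Civita connection on left-invariant fields *)
Definition gam : V -> V -> V := locked_with lock_key
  (fun x y => 2^-1 *: (br x y - adj x y - adj y x)).

Lemma gamD x y : gam x y = 2^-1 *: (br x y - adj x y - adj y x).
Proof. by rewrite /gam unlock. Qed.

Lemma gam_is_bilinear : bilinear_for
  (GRing.Scale.Law.clone _ _ *:%R _) (GRing.Scale.Law.clone _ _ *:%R _) gam.
Proof.
by split=> [x|z] a u v /=; rewrite !gamD !(linearPl, linearPr) /=;
  apply: (@dot_inj _ _ g) => w; rewrite !dotE; ring.
Qed.

HB.instance Definition _ :=
  bilinear_isBilinear.Build R V V V _ _ gam gam_is_bilinear.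

Lemma gamE x y w :
  g (gam x y) w = 2^-1 * (g (br x y) w - g x (br y w) - g y (br x w)).
Proof. by rewrite gamD !dotE !adjE. Qed.

Definition curv (a b y : V) : V :=
  gam a (gam b y) - gam b (gam a y) - gam (br a b) y.

Definition ric (x y : V) : R := \sum_i g (curv (e i) x y) (e i).

Lemma curv_linear a b : linear (curv a b).
Proof.
move=> k u v; rewrite /curv !linearPr /=.
by apply: (@dot_inj _ _ g) => w; rewrite !dotE; ring.
Qed.

Lemma curv_scalar1 b y w : scalar (fun a => g (curv a b y) w).
Proof.
by move=> k u v; rewrite /curv !(linearPl, linearPr) /= !dotE; ring.
Qed.

Lemma curv_scalar2 a y w : scalar (fun b => g (curv a b y) w).
Proof.
by move=> k u v; rewrite /curv !(linearPl, linearPr) /= !dotE; ring.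
Qed.

Lemma curv_scalar3 a b w : scalar (fun y => g (curv a b y) w).
Proof. by move=> k u v; rewrite curv_linear !dotE. Qed.

Lemma ric_scalarl y : scalar (ric^~ y).
Proof.
move=> k u v; rewrite /ric mulr_sumr -big_split/=; apply: eq_bigr => i _.
exact: curv_scalar2.
Qed.

Lemma ric_scalarr x : scalar (ric x).
Proof.
move=> k u v; rewrite /ric mulr_sumr -big_split/=; apply: eq_bigr => i _.
exact: curv_scalar3.
Qed.

Section TwoStep.
Hypothesis nbr : two_step_nilpotent br.

Lemma br_two_stepr x y w : br w (br x y) = 0.
Proof. by rewrite (bracketC nbr) (br_two_step nbr) oppr0. Qed.

Lemma gam_skew x y w : g (gam x y) w = - g y (gam x w).
Proof.
rewrite [g y _]dotC !gamE (bracketC nbr w y) dotNr (dotC _ (br x w)) (dotC _ y).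
by rewrite (dotC _ w) (dotC _ (br x w)); ring.
Qed.

Lemma gam_torsion x y : gam x y - gam y x = br x y.
Proof.
apply: (@dot_inj _ _ g) => w; rewrite !dotE !gamE (bracketC nbr y x) !dotE; lra.
Qed.

(** A bracket is central, so vanishing torsion lets it change slots in [gam]. The curvature then
    contains only iterated [gam], and the first Bianchi identity becomes a plain cancellation. *)
Lemma gam_brl x y w : gam (br x y) w = gam w (gam x y) - gam w (gam y x).
Proof.
rewrite -linearBr /= gam_torsion; apply/eqP; rewrite -subr_eq0 gam_torsion.
by rewrite (br_two_step nbr) eqxx.
Qed.

Lemma curvE a b y w : g (curv a b y) w =
  - g (gam b y) (gam a w) + g (gam a y) (gam b w) - g (gam (br a b) y) w.
Proof. by rewrite /curv !dotE (gam_skew a) (gam_skew b (gam a y)) opprK. Qed.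

Lemma curvC a b y : curv a b y = - curv b a y.
Proof.
rewrite /curv (bracketC nbr b a) linearNl /=.
by apply: (@dot_inj _ _ g) => w; rewrite !dotE; ring.
Qed.

Lemma curv_skew a b y w : g (curv a b y) w = - g y (curv a b w).
Proof.
by rewrite [in RHS]dotC !curvE (gam_skew (br a b) y) [g y (gam _ _)]dotC
  [g (gam b w) _]dotC [g (gam a w) _]dotC; ring.
Qed.

Lemma curv_bianchi a b y : curv a b y + curv b y a + curv y a b = 0.
Proof.
apply: (@dot_inj _ _ g) => w; rewrite /curv !gam_brl !dotE; ring.
Qed.

(** The octahedron argument: the Bianchi identities of the four cyclic shifts, once normalised by
    the two skew symmetries, imply it linearly. *)
Lemma curv_pair a b y w : g (curv a b y) w = g (curv y w a) b.
Proof.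
have B c d x u : g (curv c d x) u + g (curv d x c) u + g (curv x c d) u = 0.
  by rewrite -!dotDl curv_bianchi dot0l.
have A c d x u : g (curv c d x) u = - g (curv d c x) u.
  by rewrite curvC dotNl.
have S c d x u : g (curv c d x) u = - g (curv c d u) x.
  by rewrite curv_skew dotC.
have := (B a b y w, B b y w a, B y w a b, B w a b y).
rewrite (S a b w y) (S y w a b) (S b y w a) (S w a b y).
rewrite (A a y w b) (S y a w b) (A b w a y) (S w b a y).
by case=> [[[? ?] ?] ?]; lra.
Qed.

Lemma center_brl z x : z \in lie_center br -> br z x = 0.
Proof. by move=> /(lie_centerP z nbr) ->. Qed.

Lemma center_brr z x : z \in lie_center br -> br x z = 0.
Proof. by move=> zc; rewrite (bracketC nbr) center_brl ?oppr0. Qed.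

Lemma br_center x y : br x y \in lie_center br.
Proof. by apply/(lie_centerP _ nbr) => w; rewrite (br_two_step nbr). Qed.

Lemma adj_vpart z x : adj z x \in vpart br g.
Proof.
by apply: orthov_mem => w wc; rewrite adjE center_brr ?dot0r.
Qed.

Lemma adj_vpartl z x : z \in vpart br g -> adj z x = 0.
Proof.
move=> zv; apply: (@dot_inj _ _ g) => w.
by rewrite adjE dot0l (orthov_dotl zv) ?br_center.
Qed.

Lemma adj_centerr z x : x \in lie_center br -> adj z x = 0.
Proof.
move=> xc; apply: (@dot_inj _ _ g) => w.
by rewrite adjE center_brl// dot0l dot0r.
Qed.

Lemma adj_skew z x y : g (adj z x) y = - g x (adj z y).
Proof. by rewrite [in RHS]dotC !adjE (bracketC nbr x) dotNr. Qed.

Lemma dot_adj_br z x u w : g (adj z x) (br u w) = 0.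
Proof. by rewrite (orthov_dotl (adj_vpart z x) (br_center u w)). Qed.

(** [adj z x] lies in v, so it is a Riesz representative. It is the only one: central test vectors
    pair to zero with any candidate in v. *)
Lemma jmapE z x : jmap br g z x = adj z x.
Proof.
rewrite /jmap; case: xgetP => [w _ [wv wE]|/(_ (adj z x))].
  apply: (@dot_inj _ _ g) => y.
  rewrite -[y](subrKC (orth_proj g (lie_center br) y)) dotDr [RHS]dotDr.
  rewrite (orthov_dotl wv) ?orth_proj_mem//.
  rewrite (orthov_dotl (adj_vpart z x)) ?orth_proj_mem//.
  by rewrite wE ?orth_proj_compl// adjE.
by case; split; [exact: adj_vpart|move=> y _; rewrite adjE].
Qed.

(** Unimodularity: the image of [br w] is central, and cyclicity of the trace turns the projection
    onto the centre into the argument of [br w]. *)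
Lemma trace_br w : \sum_i g (br w (e i)) (e i) = 0.
Proof.
pose p := orth_proj g (lie_center br).
transitivity (\sum_i g (p (br w (e i))) (e i)).
  apply: eq_bigr => i _; rewrite /p (@orth_projE _ _ _ _ _ (br w (e i)))//.
    exact: br_center.
  by rewrite subrr mem0v.
rewrite (trace_mulC (fvecP g))/=.
- by rewrite big1// => i _; rewrite center_brr ?dot0l// orth_proj_mem.
- by move=> k u v; rewrite linearP.
- by move=> k u v; rewrite linearPr.
Qed.

(** This is the trace of [br y] after [adj x]; in the other order [adj x] meets only central
    vectors, which it kills. *)
Lemma trace_adj_br x y : \sum_i g (adj (e i) y) (adj x (e i)) = 0.
Proof.
under eq_bigr do rewrite adjE dotC.
rewrite (trace_mulC (fvecP g))/=.
- by rewrite big1// => i _; rewrite adj_centerr ?dot0l// br_center.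
- by move=> k u v; rewrite linearPr.
- by move=> k u v; rewrite linearPr.
Qed.

Lemma dot_frame x y : g x y = \sum_i g x (e i) * g y (e i).
Proof.
rewrite (@frame_scalar _ _ g _ _ (fvecP g) (g^~ y)).
  by apply: eq_bigr => i _; rewrite (dotC g y).
by move=> k u w; rewrite !dotE.
Qed.

Lemma trace_adj_adj x y : \sum_i g (adj (e i) y) (adj (e i) x) =
  \sum_i g (br x (e i)) (br y (e i)).
Proof.
under eq_bigr do rewrite dot_frame.
under [RHS]eq_bigr do rewrite dot_frame.
rewrite exchange_big/=; apply: eq_bigr => i _; apply: eq_bigr => j _.
by rewrite !adjE mulrC ![g (e j) _]dotC.
Qed.

(** The classical Ricci formula of a 2-step nilmanifold. The first sum sees only the v-components of
    x and y, the second only the z-components, which yields the block form and the signs. *)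
Lemma ricE x y : ric x y = - 2^-1 * \sum_i g (br x (e i)) (br y (e i)) +
  4^-1 * \sum_i g (adj x (e i)) (adj y (e i)).
Proof.
(* The pointwise expansion of the curvature gives six sums. Three of them have trace zero, and the
   one with [adj (e i)] in both slots equals the bracket sum, so its coefficient becomes -3/4 + 1/4
   = -1/2. *)
transitivity (- (\sum_i g (br (gam x y) (e i)) (e i)) +
  (- (3 / 4) * (\sum_i g (br x (e i)) (br y (e i)))) +
  4^-1 * ((\sum_i g (adj (e i) y) (adj x (e i))) +
          (\sum_i g (adj (e i) y) (adj (e i) x)) +
          (\sum_i g (adj (e i) x) (adj y (e i))) +
          (\sum_i g (adj x (e i)) (adj y (e i))))); last first.
  rewrite trace_br !trace_adj_br trace_adj_adj; lra.
rewrite -!big_split/= mulr_sumr -sumrN mulr_sumr -!big_split/=.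
apply: eq_bigr => i _; set f := e i.
rewrite curvE.
have -> : g (gam x y) (gam f f) = g (br (gam x y) f) f.
  have -> : gam f f = - adj f f.
    apply: (@dot_inj _ _ g) => w.
    by rewrite gamE dotNl adjE (br_alt nbr) dot0l; lra.
  by rewrite dotNr dotC adjE (bracketC nbr f) dotNr opprK dotC.
rewrite [gam f y]gamD [gam x f]gamD.
rewrite !dotE !dot_adj_br ![g (br _ _) (adj _ _)]dotC !dot_adj_br gamE.
rewrite !(br_two_step nbr) (bracketC nbr f x) (bracketC nbr f y) !dotE.
rewrite [g (adj y f) _]dotC (dotC g (adj f y) (adj f x)) [g (adj y f) _]dotC.
rewrite (dotC g (br y f)); lra.
Qed.

End TwoStep.
End MetricBracket.

(** * Sign of the Ricci form on v and on the centre *)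

Section RicciSign.
Context {R : realType} {m : nat}.
Local Notation V := 'rV[R]_m.
Context (br : {bilinear V -> V -> V}) (g : {dot V for @idfun R}).
Hypothesis nbr : two_step_nilpotent br.
Local Notation e := (fvec g).
Local Notation zc := (lie_center br).
Local Notation vp := (vpart br g).
Local Notation ric := (ric br g).

Lemma br_dot_symmetric x y :
  \sum_i g (br x (e i)) (br y (e i)) = \sum_i g (br y (e i)) (br x (e i)).
Proof. by apply: eq_bigr => i _; rewrite dotC. Qed.

Lemma ricC x y : ric x y = ric y x.
Proof.
rewrite !ricE// br_dot_symmetric; congr (_ + _ * _).
by apply: eq_bigr => i _; rewrite dotC.
Qed.

Lemma ric_vpart_center v z : v \in vp -> z \in zc -> ric v z = 0.
Proof.
move=> vv zz; rewrite ricE// !big1 ?mulr0 ?addr0// => i _.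
  by rewrite adj_vpartl// dot0l.
by rewrite (center_brl nbr _ zz) dot0r.
Qed.

Lemma ric_vpart v : v \in vp ->
  ric v v = - 2^-1 * \sum_i g (br v (e i)) (br v (e i)).
Proof.
move=> vv; rewrite ricE// [X in _ + _ * X]big1 ?mulr0 ?addr0// => i _.
by rewrite adj_vpartl// dot0l.
Qed.

Lemma ric_vpart_le0 v : v \in vp -> ric v v <= 0.
Proof.
move=> /ric_vpart ->; rewrite mulNr oppr_le0 mulr_ge0 ?invr_ge0//.
by apply: sumr_ge0 => i _; apply: dot_ge0.
Qed.

Lemma ric_vpart_eq0 v : v \in vp -> ric v v = 0 -> v = 0.
Proof.
move=> vv; rewrite ric_vpart// => /eqP; rewrite mulf_eq0 oppr_eq0 invr_eq0.
rewrite pnatr_eq0/= psumr_eq0; last by move=> i _; apply: dot_ge0.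
move=> /allP br0.
have vz : v \in zc.
  apply/(lie_centerP _ nbr) => x; rewrite (frame_sum (fvecP g) x).
  rewrite linear_sumr big1// => i _; rewrite linearZr_LR/=.
  have /eqP/dot_eq0 -> := br0 i (mem_index_enum i).
  by rewrite scaler0.
exact: dot_eq0 (orthov_dotl vv vz).
Qed.

Lemma ric_center_ge0 z : z \in zc -> 0 <= ric z z.
Proof.
move=> zz; rewrite ricE// [X in _ * X + _]big1; last first.
  by move=> i _; rewrite center_brl// dot0l.
rewrite mulr0 add0r mulr_ge0 ?invr_ge0// sumr_ge0// => i _.
exact: dot_ge0.
Qed.

Section Commute.
Context (A A' : V -> V).
Hypothesis (linA : linear A) (linA' : linear A').
Hypothesis AA' : forall x y, g (A x) y = g x (A' y).
Hypothesis ricA : forall x y, ric (A x) y = ric x (A' y).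

(* The Ricci form is negative definite on [vp], nonnegative on [zc], and [A]
   intertwines it; hence the block [b] of [A] from [zc] to [vp], with adjoint
   [b'], has tr ric(b, b) = tr ric(b', b'), a nonpositive number equal to a
   nonnegative one. *)
Lemma center_stable z : z \in zc -> A z \in zc.
Proof.
pose p := orth_proj g zc.
have [q qE] : exists q, forall x, q x = x - p x by eexists.
have [b bE] : exists b, forall x, b x = q (A (p x)) by eexists.
have [b' b'E] : exists b', forall x, b' x = p (A' (q x)) by eexists.
have pc x : p x \in zc by apply: orth_proj_mem.
have qv x : q x \in vp by rewrite qE; apply: orth_proj_compl.
have pq x : x = p x + q x by rewrite qE subrKC.
have qlin : linear q.
  by move=> k u v; rewrite !qE linearP scalerBr addrACA opprD.
have blin : linear b by move=> k u v; rewrite !bE linearP linA qlin.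
have b'lin : linear b' by move=> k u v; rewrite !b'E qlin linA' linearP.
have ricDl x y w : ric (x + y) w = ric x w + ric y w.
  by have := ric_scalarl br g w 1 x y; rewrite scale1r mul1r.
have ricDr x y w : ric w (x + y) = ric w x + ric w y.
  by rewrite ricC ricDl !(ricC w).
(* The intertwining relation of [A] and [A'] passes to their off-diagonal blocks because [ric] pairs
   v and the centre to zero. *)
have bq x u : ric (b x) (q u) = ric x (b' u).
  have -> : ric (b x) (q u) = ric (A (p x)) (q u).
    rewrite bE [in RHS](pq (A _)) ricDl [ric (p (A _)) _]ricC.
    by rewrite [ric (q u) _]ric_vpart_center// add0r.
  rewrite ricA b'E {1}(pq (A' (q u))) ricDr [ric (p x) (q _)]ricC.
  rewrite [ric (q _) (p x)]ric_vpart_center// addr0 [in RHS](pq x) ricDl.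
  by rewrite [ric (q x) _]ric_vpart_center ?addr0.
have qb x : q (b x) = b x.
  by rewrite qE (@orth_projE _ _ _ _ _ 0) ?subr0 ?mem0v// bE qv.
have bb' x y : g (b' x) y = g x (b y).
  have qadj u v : g (q u) v = g u (q v) by rewrite !qE !dotE orth_proj_adj.
  by rewrite b'E bE orth_proj_adj dotC -AA' -qadj dotC.
have E : \sum_i ric (b (e i)) (b (e i)) = \sum_i ric (b' (e i)) (b' (e i)).
  rewrite (trace_adj (fvecP g) (h := fun u w => ric u (b' w)) _ _ bb').
  - by apply: eq_bigr => i _; rewrite -bq qb.
  - by move=> w; apply: ric_scalarl.
  - by move=> u k x y; rewrite b'lin ric_scalarr.
have : \sum_i - ric (b (e i)) (b (e i)) == 0.
  rewrite eq_le sumr_ge0 ?andbT; last first.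
    by move=> i _; rewrite oppr_ge0 ric_vpart_le0 ?bE// qv.
  by rewrite sumrN oppr_le0 E sumr_ge0// => i _; rewrite ric_center_ge0 ?b'E.
rewrite psumr_eq0; last by move=> i _; rewrite oppr_ge0 ric_vpart_le0 ?bE.
move=> /allP b0 zz.
have b0' i : b (e i) = 0.
  apply: ric_vpart_eq0; first by rewrite bE qv.
  by apply/eqP; rewrite -oppr_eq0; apply: b0; apply: mem_index_enum.
have bz : b z = 0.
  have b_0 : b 0 = 0 by have := blin (-1) 0 0; rewrite scaler0 addr0 scaleN1r addNr.
  rewrite (frame_sum (fvecP g) z); apply: (big_ind (fun x => b x = 0)) => //.
    by move=> x y bx by'; have := blin 1 x y; rewrite !scale1r bx by' addr0.
  by move=> i _; rewrite -[_ *: _]addr0 blin b0' b_0 scaler0 addr0.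
have pz : p z = z by apply: orth_projE; rewrite ?subrr ?mem0v.
by rewrite (pq (A z)) -{2}pz -bE bz addr0.
Qed.

End Commute.

(** The hypotheses are symmetric in [A] and its adjoint [A'], so [A'] preserves the centre, and [A]
    preserves its orthogonal complement. *)
Lemma vpart_stable (A A' : V -> V) : linear A -> linear A' ->
  (forall x y, g (A x) y = g x (A' y)) ->
  (forall x y, ric (A x) y = ric x (A' y)) ->
  forall v, v \in vp -> A v \in vp.
Proof.
move=> lA lA' AA' ricA v vv; apply: orthov_mem => w ww.
rewrite AA' (orthov_dotl vv)//; apply: (@center_stable A' A) => // x y.
  by rewrite dotC -AA' dotC.
by rewrite ricC -ricA ricC.
Qed.

End RicciSign.

(** * Smooth maps *)

Section Differentials.
Context {R : realType} {V U U' W : normedModType R}.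

Lemma diff_linear_comp (L : U -> W) (f : V -> U) p :
  linear L -> continuous L -> differentiable f p ->
  differentiable (fun q => L (f q)) p /\
  forall v, 'D_v (fun q => L (f q)) p = L ('D_v f p).
Proof.
move=> lL cL df.
pose LM := GRing.isLinear.Build _ _ _ _ _ lL.
pose LL : {linear U -> W} := HB.pack L LM.
have dL q : differentiable LL q by apply: linear_differentiable.
have dLf : differentiable (LL \o f) p by apply: differentiable_comp.
split=> // v.
by rewrite -[LHS]/('D_v (LL \o f) p) deriveE// diff_comp//
  -[LHS]/('d LL (f p) ('d f p v)) diff_lin// deriveE.
Qed.

Definition cbilinear (b : U -> U' -> W) : Prop :=
  [/\ forall u, linear (b u), forall u', linear (b^~ u')
    & continuous (fun p => b p.1 p.2)].

Lemma diff_bilinear_comp (b : U -> U' -> W) (f : V -> U) (h : V -> U') p :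
  cbilinear b -> differentiable f p -> differentiable h p ->
  differentiable (fun q => b (f q) (h q)) p /\
  forall v, 'D_v (fun q => b (f q) (h q)) p =
    b ('D_v f p) (h p) + b (f p) ('D_v h p).
Proof.
move=> [br bl cb] df dh.
pose bM := @bilinear_isBilinear.Build R U U' W *:%R *:%R b (pair bl br).
pose B : {bilinear U -> U' -> W} := HB.pack b bM.
have dB q : differentiable (fun p => B p.1 p.2) q by apply: differentiable_bilin.
have dfh : differentiable (fun q => (f q, h q)) p by apply: differentiable_pair.
have dBf : differentiable ((fun p => B p.1 p.2) \o (fun q => (f q, h q))) p.
  exact: differentiable_comp.
split=> // v.
rewrite -[LHS]/('D_v ((fun p => B p.1 p.2) \o (fun q => (f q, h q))) p).
rewrite deriveE// diff_comp//.
rewrite -[LHS]/('d (fun p => B p.1 p.2) (f p, h p) ('d (fun q => (f q, h q)) p v)).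
by rewrite diff_bilin// diff_pair// !deriveE// addrC.
Qed.

End Differentials.

Section SmoothClosure.
Context {R : realType} {V : normedModType R}.
Implicit Types U W : normedModType R.

Lemma Cn_pred W n (f : V -> W) : Cn n.+1 f -> Cn n f.
Proof.
elim: n f => [f [df _] p|n IH f [df Df]].
  exact: differentiable_continuous.
by split=> // v; apply/IH/Df.
Qed.

Lemma smooth_diff W (f : V -> W) p : smooth f -> differentiable f p.
Proof. by move=> /(_ 1) []. Qed.

Lemma smooth_derive W (f : V -> W) v : smooth f -> smooth (fun p => 'D_v f p).
Proof. by move=> sf n; have [_ /(_ v)] := sf n.+1. Qed.

Lemma smooth_cst W (c : W) : smooth (fun _ : V => c).
Proof.
move=> n; elim: n c => [|n IH] c; first exact: cst_continuous.
split=> [p|v]; first exact: differentiable_cst.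
have -> : (fun p => 'D_v (fun=> c) p) = (fun=> 0).
  by apply/funext => p; rewrite derive_cst.
exact: IH.
Qed.

Lemma CnD W n (f h : V -> W) : Cn n f -> Cn n h -> Cn n (fun p => f p + h p).
Proof.
elim: n f h => [|n IH] f h.
  by move=> cf ch p; apply: continuousD (cf p) (ch p).
move=> [df Df] [dh Dh]; split=> [p|v]; first exact: differentiableD.
have -> : (fun p => 'D_v (fun p => f p + h p) p) =
    (fun p => 'D_v f p + 'D_v h p).
  by apply/funext => p; rewrite deriveD//; apply: diff_derivable.
exact: IH (Df v) (Dh v).
Qed.

Lemma smoothD W (f h : V -> W) : smooth f -> smooth h ->
  smooth (fun p => f p + h p).
Proof. by move=> sf sh n; apply: CnD. Qed.

Lemma smooth_sum W I (r : seq I) (F : I -> V -> W) :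
  (forall i, smooth (F i)) -> smooth (fun p => \sum_(i <- r) F i p).
Proof.
move=> sF; elim: r => [|i r IH].
  by under eq_fun do rewrite big_nil; apply: smooth_cst.
by under eq_fun do rewrite big_cons; apply: smoothD.
Qed.

Lemma smooth_linear_comp U W (L : U -> W) (f : V -> U) :
  linear L -> continuous L -> smooth f -> smooth (fun p => L (f p)).
Proof.
move=> lL cL sf n; move: (sf n); elim: n f {sf} => [|n IH] f.
  by move=> cf p; exact: (@continuous_comp _ _ _ f L p (cf p) (cL (f p))).
move=> [df Df]; split=> [p|v]; first exact: (diff_linear_comp lL cL (df p)).1.
have -> : (fun p => 'D_v (fun q => L (f q)) p) = (fun p => L ('D_v f p)).
  by apply/funext => p; rewrite (diff_linear_comp lL cL (df p)).2.
exact/IH/Df.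
Qed.

Lemma smooth_bilinear_comp U U' W (b : U -> U' -> W) (f : V -> U) (h : V -> U') :
  cbilinear b -> smooth f -> smooth h -> smooth (fun p => b (f p) (h p)).
Proof.
move=> hb sf sh n; move: (sf n) (sh n); elim: n f h {sf sh} => [|n IH] f h.
  move=> cf ch p; have [_ _ cb] := hb.
  apply: (@continuous_comp _ _ _ (fun q => (f q, h q)) (fun p => b p.1 p.2)).
    by apply: cvg_pair; [exact: cf|exact: ch].
  exact: cb.
move=> Cf Ch; have [df Df] := Cf; have [dh Dh] := Ch.
split=> [p|v]; first exact: (diff_bilinear_comp hb (df p) (dh p)).1.
have -> : (fun p => 'D_v (fun q => b (f q) (h q)) p) =
    (fun p => b ('D_v f p) (h p) + b (f p) ('D_v h p)).
  by apply/funext => p; rewrite (diff_bilinear_comp hb (df p) (dh p)).2.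
exact: CnD (IH _ _ (Df v) (Cn_pred Ch)) (IH _ _ (Cn_pred Cf) (Dh v)).
Qed.

Lemma cbilinear_mul : cbilinear (fun a b : R => a * b).
Proof.
split=> [u k x y|u k x y|]; last exact: mul_continuous.
- by rewrite mulrDr -!scalerAr.
- by rewrite mulrDl -!scalerAl.
Qed.

Lemma cbilinear_scale W : cbilinear (fun (a : R) (w : W) => a *: w).
Proof.
split=> [u k x y|u k x y|]; last exact: scale_continuous.
- by rewrite scalerDr !scalerA mulrC.
- by rewrite scalerDl scalerA.
Qed.

End SmoothClosure.

Section RowVectors.
Context {R : realType}.
Implicit Types W : normedModType R.

Lemma linear_row m (W : lmodType R) (L : 'rV[R]_m -> W) x : linear L ->
  L x = \sum_i x ord0 i *: L (delta_mx ord0 i).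
Proof.
move=> lL; pose LM := GRing.isLinear.Build _ _ _ _ _ lL.
pose LL : {linear 'rV[R]_m -> W} := HB.pack L LM.
rewrite [in LHS](row_sum_delta x) -[LHS]/(LL _) linear_sum.
by apply: eq_bigr => i _; rewrite linearZ.
Qed.

Lemma linear_continuous_row m W (L : 'rV[R]_m -> W) : linear L -> continuous L.
Proof.
move=> lL; have -> : L = fun x => \sum_i x ord0 i *: L (delta_mx ord0 i).
  by apply/funext => x; apply: linear_row.
apply: continuous_big; first exact: add_continuous.
move=> i _ x; apply: continuousZr_tmp; exact: coord_continuous.
Qed.

Lemma cbilinear_row m m' W (b : 'rV[R]_m -> 'rV[R]_m' -> W) :
  (forall u, linear (b u)) -> (forall u', linear (b^~ u')) -> cbilinear b.
Proof.
move=> br bl; split=> //.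
have -> : (fun p => b p.1 p.2) =
    fun p => \sum_i p.1 ord0 i *: b (delta_mx ord0 i) p.2.
  by apply/funext => p; apply: (linear_row p.1 (bl p.2)).
apply: continuous_big; first exact: add_continuous.
move=> i _ p; apply: cvgZ.
  exact: (@continuous_comp _ _ _ fst (fun x : 'rV[R]_m => x ord0 i) p cvg_fst
    (@coord_continuous _ _ _ _ _ _)).
apply: (@continuous_comp _ _ _ snd (b (delta_mx ord0 i)) p); first exact: cvg_snd.
exact/linear_continuous_row/br.
Qed.

Lemma diff_linear m W (L : 'rV[R]_m -> W) p : linear L ->
  differentiable L p /\ forall v, 'D_v L p = L v.
Proof.
move=> lL; have did : differentiable (@id 'rV[R]_m) p by apply: ex_diff.
have [dL DL] := diff_linear_comp lL (linear_continuous_row lL) did.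
by split=> // v; rewrite DL derive_id.
Qed.

Lemma smooth_linear m W (L : 'rV[R]_m -> W) : linear L -> smooth L.
Proof.
move=> lL [|n]; first exact: linear_continuous_row.
split=> [p|v]; first by have [] := diff_linear p lL.
have -> : (fun p => 'D_v L p) = (fun=> L v).
  by apply/funext => p; have [_ ->] := diff_linear p lL.
exact: smooth_cst.
Qed.

End RowVectors.

(** * Symmetry of second derivatives *)

Section Schwarz.
Context {R : realType} {V : normedModType R}.
Implicit Types f : V -> R.

Lemma is_derive_line f p v (t : R) : differentiable f (p + t *: v) ->
  is_derive t 1 (fun s : R => f (p + s *: v)) ('D_v f (p + t *: v)).
Proof.
move=> df.
have E : (fun h : R => h^-1 *: (f (p + (h *: 1 + t) *: v) - f (p + t *: v))) =
    (fun h => h^-1 *: (f (h *: v + (p + t *: v)) - f (p + t *: v))).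
  by apply/funext => h; rewrite scalerDl [h *: 1]mulr1 addrCA.
apply: DeriveDef; last by rewrite /derive E.
rewrite /derivable E; exact: diff_derivable.
Qed.

Lemma MVT_line f p v (h : R) : (forall q, differentiable f q) -> 0 < h ->
  exists2 c, 0 <= c <= h & f (p + h *: v) - f p = 'D_v f (p + c *: v) * h.
Proof.
move=> df h0.
have dl t := is_derive_line (df (p + t *: v)).
have [|c cI E] := MVT h0 (fun x _ => dl x).
  apply: continuous_subspaceT => t.
  exact/differentiable_continuous/derivable1_diffP/ex_derive.
exists c; first by move: cI; rewrite in_itv/= => /andP[/ltW -> /ltW].
by rewrite scale0r addr0 subr0 in E.
Qed.

(** Two uses of the mean value theorem: along u for the increment of f in direction v, then along v
    for the derivative of f in direction u. *)
Lemma second_difference f p u v (h : R) : smooth f -> 0 < h ->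
  exists s t, [/\ 0 <= s <= h, 0 <= t <= h &
    f (p + h *: u + h *: v) - f (p + h *: u) - f (p + h *: v) + f p =
    'D_v (fun q => 'D_u f q) (p + s *: u + t *: v) * h ^+ 2].
Proof.
move=> sf h0.
pose F q := f (q + h *: v) - f q.
have dshift q : differentiable (fun q => f (q + h *: v)) q.
  apply: (@differentiable_comp _ _ _ _ (fun q => q + h *: v) f).
    apply: (@differentiableD _ _ _ id (cst (h *: v))).
      exact: ex_diff.
    exact: differentiable_cst.
  exact: smooth_diff.
have dF q : differentiable F q.
  exact: (differentiableB (dshift q) (smooth_diff q sf)).
have [s sI Es] := MVT_line p u dF h0.
have DF q : 'D_u F q = 'D_u f (q + h *: v) - 'D_u f q.
  rewrite [LHS](deriveB (diff_derivable (dshift q))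
    (diff_derivable (smooth_diff q sf))).
  congr (_ - _); rewrite /derive /=.
  by under [in LHS]eq_fun do rewrite -addrA.
have dDu q : differentiable (fun q => 'D_u f q) q.
  exact/smooth_diff/smooth_derive.
have [t tI Et] := MVT_line (p + s *: u) v dDu h0.
exists s, t; split=> //; rewrite expr2 mulrA -Et -DF -Es /F; ring.
Qed.

(** The second difference is symmetric in u and v, so both mixed derivatives take a common value, at
    two points as close to p as desired; continuity at p concludes. *)
Lemma derive_comm f p u v : smooth f ->
  'D_v (fun q => 'D_u f q) p = 'D_u (fun q => 'D_v f q) p.
Proof.
move=> sf; apply/eqP; rewrite -subr_eq0; apply/eqP.
set Duv := fun q => 'D_v (fun q => 'D_u f q) q.
set Dvu := fun q => 'D_u (fun q => 'D_v f q) q.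
have cuv : {for p, continuous Duv}.
  exact/differentiable_continuous/smooth_diff/smooth_derive/smooth_derive.
have cvu : {for p, continuous Dvu}.
  exact/differentiable_continuous/smooth_diff/smooth_derive/smooth_derive.
apply/eqP; rewrite -normr_le0; apply/ler_addgt0Pr => e e0; rewrite add0r.
have e20 : 0 < e / 2 by rewrite divr_gt0.
have /nbhs_normP[d1 /= d10 H1] : \forall q \near p, `|Duv p - Duv q| < e / 2.
  by move/cvgrPdist_lt : cuv; apply.
have /nbhs_normP[d2 /= d20 H2] : \forall q \near p, `|Dvu p - Dvu q| < e / 2.
  by move/cvgrPdist_lt : cvu; apply.
pose d := Num.min d1 d2; have d0 : 0 < d by rewrite lt_min d10.
(* The summand 1 keeps [M] positive even when u and v vanish; the displacements are then at most
   [h * M = d / 2]. *)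
pose M := `|u| + `|v| + 1.
have M0 : 0 < M by rewrite ltr_wpDl// addr_ge0.
pose h := d / 2 / M; have h0 : 0 < h by rewrite !divr_gt0.
have near_p x y s t : `|x| + `|y| <= M -> 0 <= s <= h -> 0 <= t <= h ->
    `|p - (p + s *: x + t *: y)| < d.
  move=> xyM /andP[s0 sh] /andP[t0 th].
  rewrite -addrA opprD addNKr normrN.
  apply: (le_lt_trans (ler_normD _ _)); rewrite !normrZ !ger0_norm//.
  apply: (@le_lt_trans _ _ (h * M)).
    apply: (le_trans _ (ler_wpM2l (ltW h0) xyM)); rewrite mulrDr.
    by rewrite lerD// ler_wpM2r.
  by rewrite /h divfK ?gt_eqF// ltr_pdivrMr// ltr_pMr// ltr1n.
have [s [t [sI tI E1]]] := second_difference p u v sf h0.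
have [s' [t' [s'I t'I E2]]] := second_difference p v u sf h0.
have E : Duv (p + s *: u + t *: v) = Dvu (p + s' *: v + t' *: u).
  have hn : h ^+ 2 != 0 by rewrite expf_neq0// gt_eqF.
  apply: (mulIf hn); apply: etrans (esym E1) (etrans _ E2).
  by rewrite (addrAC p (h *: v)); congr (_ + _); exact: addrAC.
have A1 : `|Duv p - Duv (p + s *: u + t *: v)| < e / 2.
  apply: H1 => /=; apply: lt_le_trans (near_p _ _ _ _ _ sI tI) _.
    by rewrite /M lerDl.
  by rewrite ge_min lexx.
have A2 : `|Dvu p - Dvu (p + s' *: v + t' *: u)| < e / 2.
  apply: H2 => /=; apply: lt_le_trans (near_p _ _ _ _ _ s'I t'I) _.
    by rewrite /M [`|v| + _]addrC lerDl.
  by rewrite ge_min lexx orbT.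
rewrite -E in A2.
have split_diff (a b c : R) : a - b = (a - c) - (b - c) by ring.
rewrite (split_diff _ _ (Duv (p + s *: u + t *: v))).
apply: (le_trans (ler_normB _ _)); rewrite (splitr e).
exact: lerD (ltW A1) (ltW A2).
Qed.

End Schwarz.

Section VectorFields.
Context {R : realType} {m : nat}.
Local Notation V := 'rV[R]_m.
Implicit Types (W : normedModType R) (X Y : V -> V) (f : V -> R).

Lemma diff_sum W n (F : 'I_n -> V -> W) p :
  (forall i, differentiable (F i) p) ->
  differentiable (fun q => \sum_i F i q) p /\
  forall v, 'D_v (fun q => \sum_i F i q) p = \sum_i 'D_v (F i) p.
Proof.
move=> dF; have E : (fun q => \sum_i F i q) = \sum_i F i.
  by apply/funext => q; rewrite fct_sumE.
split=> [|v]; rewrite E; first exact: differentiable_sum.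
by rewrite derive_sum// => i; apply: diff_derivable.
Qed.

Lemma derive_lincomb W (f : V -> W) p k u v : differentiable f p ->
  'D_(k *: u + v) f p = k *: 'D_u f p + 'D_v f p.
Proof. by move=> df; rewrite !deriveE// linearP. Qed.

Lemma derive_lin_dir W (f : V -> W) p : differentiable f p ->
  linear (fun v => 'D_v f p).
Proof. by move=> df k u v; apply: derive_lincomb. Qed.

Lemma derive_coord f p v : differentiable f p ->
  'D_v f p = \sum_i v ord0 i * 'D_(delta_mx ord0 i) f p.
Proof. by move=> df; apply: (linear_row v (derive_lin_dir df)). Qed.

Lemma coord_linear i : linear (fun v : V => v ord0 i).
Proof. by move=> k u v; rewrite !mxE. Qed.

Lemma smooth_coord X i : smooth X -> smooth (fun p => X p ord0 i).
Proof.
move=> sX; apply: (@smooth_linear_comp _ _ _ _ (fun v : V => v ord0 i)) => //.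
  exact: coord_linear.
exact/linear_continuous_row/coord_linear.
Qed.

Lemma smooth_dir X f : smooth X -> smooth f -> smooth (dir X f).
Proof.
move=> sX sf.
have -> : dir X f = fun p => \sum_i X p ord0 i * 'D_(delta_mx ord0 i) f p.
  by apply/funext => p; rewrite /dir derive_coord//; apply: smooth_diff.
apply: smooth_sum => i; apply: (smooth_bilinear_comp cbilinear_mul).
  exact: smooth_coord.
exact: smooth_derive.
Qed.

Lemma derive_dir X f p w : smooth X -> smooth f ->
  'D_w (dir X f) p = 'D_('D_w X p) f p + 'D_w (fun q => 'D_(X p) f q) p.
Proof.
move=> sX sf; have df q := smooth_diff q sf.
have dDf i q : differentiable (fun q => 'D_(delta_mx ord0 i) f q) q.
  exact/smooth_diff/smooth_derive.
have dX i : differentiable (fun q => X q ord0 i) p.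
  exact/smooth_diff/smooth_coord.
have -> : dir X f = fun p => \sum_i X p ord0 i * 'D_(delta_mx ord0 i) f p.
  by apply/funext => q; rewrite /dir derive_coord.
have -> : (fun q => 'D_(X p) f q) =
    fun q => \sum_i X p ord0 i * 'D_(delta_mx ord0 i) f q.
  by apply/funext => q; rewrite derive_coord.
have dc i : differentiable (fun _ : V => X p ord0 i) p by apply: differentiable_cst.
rewrite (diff_sum (fun i => (diff_bilinear_comp cbilinear_mul (dX i) (dDf i p)).1)).2.
rewrite (diff_sum (fun i => (diff_bilinear_comp cbilinear_mul (dc i) (dDf i p)).1)).2.
rewrite (derive_coord _ (df p)) -big_split/=; apply: eq_bigr => i _.
rewrite (diff_bilinear_comp cbilinear_mul (dX i) (dDf i p)).2.
rewrite (diff_bilinear_comp cbilinear_mul (dc i) (dDf i p)).2.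
rewrite derive_cst mul0r add0r; congr (_ * _ + _).
rewrite (diff_linear_comp (@coord_linear i) (linear_continuous_row (@coord_linear i))
  (smooth_diff p sX)).2 //.
Qed.

(** The second-order terms, with both fields frozen at p, cancel by symmetry of second derivatives;
    the terms that differentiate the fields form the commutator. *)
Lemma dir_bracket X Y f p : smooth X -> smooth Y -> smooth f ->
  dir X (dir Y f) p - dir Y (dir X f) p = dir (vf_bracket X Y) f p.
Proof.
move=> sX sY sf; have cancel (a b c d : R) : d = b -> a + b - (c + d) = a - c.
  by move=> ->; rewrite opprD addrACA subrr addr0.
have dlin u v : 'D_u f p - 'D_v f p = 'D_(u - v) f p.
  have E := derive_lin_dir (smooth_diff p sf) (-1) v u.
  by rewrite [u - v]addrC -(scaleN1r v) E scaleN1r addrC.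
apply: etrans (congr2 (fun a b => a - b) (derive_dir p (X p) sY sf)
  (derive_dir p (Y p) sX sf)) _.
apply: etrans (cancel _ _ _ _ (derive_comm p (X p) (Y p) sf)) _.
exact: dlin.
Qed.

End VectorFields.

(** * Left-invariant fields *)

Section LeftInvariantFields.
Context {R : realType} {m : nat}.
Local Notation V := 'rV[R]_m.
Context (br : {bilinear V -> V -> V}) (g : {dot V for @idfun R}).
Hypothesis nbr : two_step_nilpotent br.
Local Notation lt := (left_triv br).
Local Notation metric := (left_metric br g).

(** The left-invariant field with value x at 0: the derivative of [gmul br p] at 0 in the direction
    x. *)
Definition lfield (x : V) : V -> V := fun p => x + 2^-1 *: br p x.

Lemma br_linear x : linear (br x).
Proof. by move=> k u v; rewrite linearPr. Qed.

Lemma br_linearl x : linear (br^~ x).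
Proof. by move=> k u v; rewrite linearPl. Qed.

Lemma cbilinear_br : cbilinear br.
Proof. exact: cbilinear_row br_linear br_linearl. Qed.

Lemma dot_linear x : linear (g x : V -> R).
Proof. by move=> k u v; rewrite !dotE. Qed.

Lemma dot_linearl x : linear (g^~ x : V -> R).
Proof. by move=> k u v; rewrite !dotE. Qed.

Lemma cbilinear_dot : cbilinear (g : V -> V -> R).
Proof. exact: cbilinear_row dot_linear dot_linearl. Qed.

Lemma lfield0 x : lfield x 0 = x.
Proof. by rewrite /lfield linear0l scaler0 addr0. Qed.

Lemma lfield_linear p : linear (lfield^~ p).
Proof.
move=> k u v; rewrite /lfield linearPr.
by rewrite scalerDr scalerA mulrC -scalerA addrACA scalerDr.
Qed.

Lemma left_triv_linear p : linear (lt p).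
Proof.
move=> k u v; rewrite !left_trivE// linearPr scalerDr opprD addrACA scalerBr.
by rewrite !scalerA mulrC.
Qed.

Lemma left_trivB p u v : lt p (u - v) = lt p u - lt p v.
Proof.
by rewrite [u - v]addrC -(scaleN1r v) left_triv_linear scaleN1r addrC.
Qed.

Lemma left_triv_lfield x p : lt p (lfield x p) = x.
Proof.
rewrite left_trivE// /lfield linearDr linearZr_LR /= br_two_stepr//.
by rewrite !scaler0 addr0 addrK.
Qed.

Lemma lfield_left_triv u p : lfield (lt p u) p = u.
Proof.
rewrite left_trivE// /lfield linearBr linearZr_LR /= br_two_stepr//.
by rewrite scaler0 subr0 subrK.
Qed.

Lemma metric_lfield p x y : metric p (lfield x p) (lfield y p) = g x y.
Proof. by rewrite /left_metric /left_inv !left_triv_lfield. Qed.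

Lemma smooth_br (X Y : V -> V) : smooth X -> smooth Y ->
  smooth (fun p => br (X p) (Y p)).
Proof. exact: smooth_bilinear_comp cbilinear_br. Qed.

Lemma smooth_id : smooth (@id V).
Proof. exact: smooth_linear. Qed.

Lemma smooth_scale (k : R) (X : V -> V) : smooth X -> smooth (fun p => k *: X p).
Proof.
by move=> sX; apply: (smooth_bilinear_comp (cbilinear_scale _) (smooth_cst k) sX).
Qed.

Lemma smooth_lfield x : smooth (lfield x).
Proof.
apply: smoothD; first exact: smooth_cst.
apply/smooth_scale/smooth_linear/br_linearl.
Qed.

Lemma smooth_left_triv (X : V -> V) : smooth X -> smooth (fun p => lt p (X p)).
Proof.
move=> sX; have -> : (fun p => lt p (X p)) = fun p => X p + (- 2^-1) *: br p (X p).
  by apply/funext => p; rewrite left_trivE// scaleNr.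
by apply/smoothD/smooth_scale/smooth_br => //; apply: smooth_id.
Qed.

Lemma derive_lfield x p w : 'D_w (lfield x) p = 2^-1 *: br w x.
Proof.
have lin : linear (fun p => 2^-1 *: br p x).
  by move=> k u v; rewrite linearPl scalerDr !scalerA mulrC.
have [dl Dl] := diff_linear p lin.
rewrite /lfield deriveD; [|exact: derivable_cst|exact: diff_derivable].
by rewrite derive_cst add0r Dl.
Qed.

Lemma bracket_lfield x y p : vf_bracket (lfield x) (lfield y) p = lfield (br x y) p.
Proof.
rewrite /vf_bracket !derive_lfield /lfield !linearDl /= !linearZl_LR /=.
rewrite !(br_two_step nbr) br_two_stepr// !scaler0 !addr0.
rewrite (bracketC nbr y x) scalerN opprK -scalerDl.
have -> : 2^-1 + 2^-1 = 1 :> R by lra.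
by rewrite scale1r.
Qed.

Lemma dir_lfield_comm (x y : V) (f : V -> R) p : smooth f ->
  dir (lfield x) (dir (lfield y) f) p - dir (lfield y) (dir (lfield x) f) p =
  dir (lfield (br x y)) f p.
Proof.
move=> sf; apply: etrans (dir_bracket p (smooth_lfield x) (smooth_lfield y) sf) _.
by rewrite /dir bracket_lfield.
Qed.

Section Connection.
Context (nabla : (V -> V) -> (V -> V) -> V -> V).
Hypothesis LC : levi_civita metric nabla.
Local Notation gam := (gam br g).

(** Koszul's trick: skewness in the last two slots together with the antisymmetric part in the first
    two determines a trilinear expression. It yields both the connection and the derivative of
    [lie_der]. *)
Lemma koszul_unique (T : V -> V -> V -> R) (K : V -> V -> V -> R) x y w :
  (forall x y w, T x y w = - T x w y) ->
  (forall x y w, T x y w - T y x w = K x y w) ->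
  T x y w = 2^-1 * (K x y w - K y w x + K w x y).
Proof.
move=> skew tor.
have := (tor x y w, tor y w x, tor w x y, skew x y w, skew y x w, skew w x y).
by case=> [[[[[? ?] ?] ?] ?] ?]; lra.
Qed.

(** Scalar products of left-invariant fields are constant, so metric compatibility is skewness in
    the last two slots, and vanishing torsion supplies the antisymmetric part. *)
Lemma nabla_lfield x y p : nabla (lfield x) (lfield y) p = lfield (gam x y) p.
Proof.
pose T x y w := g (lt p (nabla (lfield x) (lfield y) p)) w.
have Tskew a b c : T a b c = - T a c b.
  have := lc_metric LC (smooth_lfield a) (smooth_lfield b) (smooth_lfield c) p.
  rewrite /dir.
  under eq_fun do rewrite metric_lfield.
  rewrite derive_cst /left_metric /left_inv !left_triv_lfield /T => /eqP.
  by rewrite eq_sym addr_eq0 (dotC g b) => /eqP.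
have Ttor a b c : T a b c - T b a c = g (br a b) c.
  have := lc_torsion LC (smooth_lfield a) (smooth_lfield b) p.
  rewrite bracket_lfield // => /(congr1 (lt p)); rewrite left_triv_lfield => <-.
  by rewrite left_trivB !dotE.
rewrite -[LHS](lfield_left_triv _ p); congr (lfield _ p).
apply: (@dot_inj _ _ g) => w; rewrite -/(T x y w).
rewrite (koszul_unique (K := fun a b c => g (br a b) c) _ _ _ Tskew Ttor) gamE//.
by rewrite (dotC _ _ x) (dotC _ _ y) (bracketC nbr x w) !dotE; ring.
Qed.

End Connection.
End LeftInvariantFields.

(** * Killing fields *)

Section CurvatureInvariance.
Context {R : realType} {m : nat}.
Local Notation V := 'rV[R]_m.
Context (br : {bilinear V -> V -> V}) (g : {dot V for @idfun R}).
Hypothesis nbr : two_step_nilpotent br.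
Local Notation gam := (gam br g).
Local Notation curv := (curv br g).
Local Notation ric := (ric br g).
Local Notation e := (fvec g).

Section Skew.
Context (B : V -> V).
Hypothesis linB : linear B.
Hypothesis skewB : forall x y, g (B x) y = - g x (B y).

Lemma linear_sub x y : B (x - y) = B x - B y.
Proof. by rewrite [x - y]addrC -(scaleN1r y) linB scaleN1r addrC. Qed.

(* This is the derivative along x of the matrix coefficient (y, w) of [B], when
   [B] is the Lie derivative along a Killing field. *)
Definition nabla_skew (x y w : V) : R :=
  g (B (gam x y)) w + g (B y) (gam x w) - g (gam (B x) y) w.

Lemma nabla_skew_antisym x y w : nabla_skew x y w = - nabla_skew x w y.
Proof.
rewrite /nabla_skew (skewB (gam x y)) (skewB (gam x w)) (gam_skew _ nbr (B x) y).
by rewrite (dotC g (gam x y)) (dotC g (gam x w)) (dotC g y); ring.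
Qed.

Lemma nabla_skew_torsion x y w : nabla_skew x y w - nabla_skew y x w =
  g (B (br x y)) w - g (br (B x) y) w - g (br x (B y)) w.
Proof.
rewrite /nabla_skew -!(gam_torsion g nbr) linear_sub !dotE.
rewrite (dotC g (B y)) (dotC g (B x)) (gam_skew _ nbr x w) (gam_skew _ nbr y w).
by rewrite !(dotC g w); ring.
Qed.

(** With this [t] the last term of [nabla_skew] is again a matrix coefficient of [B], so the
    derivative formula can be applied to it a second time. *)
Lemma dot_gaml y w : exists t, forall u, g u t = g (gam u y) w.
Proof.
exists (2^-1 *: (- adj br g w y - br y w + adj br g y w)) => u.
rewrite gamE// !dotE (dotC g u (adj _ _ _ _)) (dotC g u (adj _ _ y w)) !adjE.
by rewrite (bracketC nbr u y) (bracketC nbr u w) (dotC g w) !dotE; ring.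
Qed.

(* The second hypothesis is the commutation of left-invariant derivatives of the
   matrix coefficients of [B]; it turns into the invariance of the curvature. *)
Lemma curv_skewB a b y w t : (forall u, g u t = g (gam u y) w) ->
  nabla_skew a (gam b y) w + nabla_skew a y (gam b w) - nabla_skew a b t
  - (nabla_skew b (gam a y) w + nabla_skew b y (gam a w) - nabla_skew b a t)
  = nabla_skew (br a b) y w ->
  g (B (curv a b y)) w + g (B y) (curv a b w) =
  g (curv (B a) b y) w + g (curv a (B b) y) w.
Proof.
move=> tE; rewrite /nabla_skew /curv.
rewrite !(tE, linear_sub).
have S c d : g (B c) (gam d t) = - g (gam (gam d (B c)) y) w.
  by rewrite -tE (gam_skew _ nbr) opprK.
rewrite !S -!(gam_torsion g nbr) !(linearBl, linearBr) /= !linear_sub !dotE.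
rewrite ![g (gam (B a) y) (gam b w)]dotC (gam_skew _ nbr b w) (dotC g w).
rewrite ![g (gam (B b) y) (gam a w)]dotC (gam_skew _ nbr a w) (dotC g w).
rewrite linearBl /= !dotE => E; lra.
Qed.

(** Contract the invariance over a = w = [e i]: the terms where [B] acts on the curvature value and
    on the first slot have equal traces because [B] is skew, and the other two are Ricci terms. *)
Lemma ric_skewB :
  (forall a b y w, g (B (curv a b y)) w + g (B y) (curv a b w) =
    g (curv (B a) b y) w + g (curv a (B b) y) w) ->
  forall x y, ric (B x) y = ric x (- B y).
Proof.
move=> inv x y.
have E : \sum_i g (curv (B (e i)) x y) (e i) =
    \sum_i g (B (curv (e i) x y)) (e i).
  rewrite (trace_adj (fvecP g) (h := fun u w => g (curv u x y) w)
    (b := B) (b' := fun w => - B w)).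
  - by apply: eq_bigr => i _; rewrite skewB dotNr.
  - by move=> w; apply: curv_scalar1.
  - by move=> u k v w; rewrite dotDr dotZr.
  - by move=> u v; rewrite skewB dotNr.
have : \sum_i (g (B (curv (e i) x y)) (e i) + g (B y) (curv (e i) x (e i))) =
  \sum_i (g (curv (B (e i)) x y) (e i) + g (curv (e i) (B x) y) (e i)).
  by apply: eq_bigr => i _.
rewrite !big_split /= E => /addrI; rewrite -/(ric (B x) y) => <-.
by apply: eq_bigr => i _; rewrite [RHS]curv_skew// dotNl opprK.
Qed.

End Skew.
End CurvatureInvariance.

Section KillingFields.
Context {R : realType} {m : nat}.
Local Notation V := 'rV[R]_m.
Context (br : {bilinear V -> V -> V}) (g : {dot V for @idfun R}).
Hypothesis nbr : two_step_nilpotent br.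
Local Notation lt := (left_triv br).
Local Notation lf := (lfield br).
Local Notation metric := (left_metric br g).
Local Notation gam := (gam br g).
Local Notation curv := (curv br g).
Local Notation ric := (ric br g).
Local Notation zc := (lie_center br).
Local Notation vp := (vpart br g).

Context (xi : V -> V).
Hypothesis killing : killing_field metric xi.

Let F p := lt p (xi p).

Lemma smooth_triv_field : smooth F.
Proof. by case: killing => sxi _; apply: smooth_left_triv. Qed.

(* the Lie derivative of left-invariant fields along [- xi], read in the left
   trivialization *)
Definition lie_der : V -> V -> V := locked_with lock_key
  (fun p x => 'D_(lf x p) F p + br x (F p)).

Lemma lie_derD p x : lie_der p x = 'D_(lf x p) F p + br x (F p).
Proof. by rewrite /lie_der unlock. Qed.

Let dF p : differentiable F p.
Proof. exact: smooth_diff smooth_triv_field. Qed.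

Lemma derive_triv_field p x : 'D_(lf x p) F p = lie_der p x - br x (F p).
Proof. by rewrite lie_derD addrK. Qed.

Lemma lie_der_linear p : linear (lie_der p).
Proof.
move=> k u v; rewrite !lie_derD linearPl /= lfield_linear.
rewrite (derive_lincomb _ _ _ (dF p)).
move: ('D_(lf u p) F p) ('D_(lf v p) F p) => c d.
by rewrite scalerDr addrACA.
Qed.

Lemma lie_derE p x : lt p (vf_bracket xi (lf x) p) = - lie_der p x.
Proof.
have xiE : xi = fun p => F p + 2^-1 *: br p (F p).
  by apply/funext => q; rewrite -/(lf (F q) q) lfield_left_triv.
have did : differentiable (@id V) p by apply: ex_diff.
have [db Db] := diff_bilinear_comp (cbilinear_br br) did (dF p).
have dhb : differentiable (fun q => 2^-1 *: br q (F q)) p.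
  exact: differentiableZ.
have Dxi w : 'D_w xi p = 'D_w F p + 2^-1 *: (br w (F p) + br p ('D_w F p)).
  rewrite {1}xiE (deriveD (diff_derivable (dF p)) (diff_derivable dhb)).
  by rewrite (deriveZ _ (diff_derivable db)) Db derive_id.
rewrite /vf_bracket derive_lfield Dxi lie_derD left_trivE//.
move: ('D_(lf x p) F p) => D.
rewrite xiE /lfield !(linearDl, linearDr, linearBr, linearZl_LR, linearZr_LR) /=.
rewrite !(br_two_stepr nbr, br_two_step nbr) (bracketC nbr (F p) x).
rewrite !(linearDr, linearZr_LR, linearNr) /= !(br_two_stepr nbr).
by apply: (@dot_inj _ _ g) => w; rewrite !dotE; lra.
Qed.

(** This is the Killing equation on left-invariant fields, whose scalar products have zero
    derivative along [xi]. *)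
Lemma lie_der_skew p x y : g (lie_der p x) y = - g x (lie_der p y).
Proof.
have [_ /(_ _ _ (smooth_lfield br x) (smooth_lfield br y) p)] := killing.
rewrite /dir; under eq_fun do rewrite metric_lfield//.
rewrite derive_cst.
have E u v : metric p (vf_bracket xi (lf u) p) (lf v p) = - g (lie_der p u) v.
  by rewrite /left_metric /left_inv lie_derE left_triv_lfield// dotNl.
have E' u v : metric p (lf v p) (vf_bracket xi (lf u) p) = - g (lie_der p u) v.
  by rewrite -E; apply: dotC.
rewrite (E x y) (E' y x) sub0r !opprK [g x _]dotC => /eqP.
by rewrite addr_eq0 => /eqP.
Qed.

Let b y w p := g (lie_der p y) w.

Lemma derive_triv_dot x w p :
  dir (lf x) (fun q => g (F q) w) p = b x w p - g (br x (F p)) w.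
Proof.
rewrite /dir; have [_ ->] := diff_linear_comp (@dot_linearl _ _ g w)
  (linear_continuous_row (@dot_linearl _ _ g w)) (dF p).
by rewrite derive_triv_field !dotE.
Qed.

Lemma smooth_triv_dot w : smooth (fun q => g (F q) w).
Proof.
apply: (@smooth_linear_comp _ _ _ _ (g^~ w : V -> R)).
- exact: dot_linearl.
- exact/linear_continuous_row/dot_linearl.
- exact: smooth_triv_field.
Qed.

Lemma lie_der_dotE y w : b y w =
  fun q => dir (lf y) (fun q => g (F q) w) q + g (br y (F q)) w.
Proof. by apply/funext => q; rewrite derive_triv_dot subrK. Qed.

Lemma br_dot_linear y w : linear (fun v : V => g (br y v) w : R).
Proof. by move=> k u v; rewrite linearPr /= !dotE. Qed.

Lemma smooth_lie_der y w : smooth (b y w).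
Proof.
rewrite lie_der_dotE; apply: smoothD.
  exact: smooth_dir (smooth_lfield br y) (smooth_triv_dot w).
apply: (@smooth_linear_comp _ _ _ _ (fun v : V => g (br y v) w : R)).
- exact: br_dot_linear.
- exact/linear_continuous_row/br_dot_linear.
- exact: smooth_triv_field.
Qed.

Lemma dir_lie_der x y w p : dir (lf x) (b y w) p =
  dir (lf x) (dir (lf y) (fun q => g (F q) w)) p + g (br y (lie_der p x)) w.
Proof.
have [db Db] := diff_linear_comp (@br_dot_linear y w)
  (linear_continuous_row (@br_dot_linear y w)) (dF p).
have dd : differentiable (dir (lf y) (fun q => g (F q) w)) p.
  exact/smooth_diff/smooth_dir/smooth_triv_dot/smooth_lfield.
rewrite lie_der_dotE [LHS](deriveD (diff_derivable dd) (diff_derivable db)).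
congr (_ + _); rewrite Db derive_triv_field linearBr /=.
by rewrite (br_two_stepr nbr) subr0.
Qed.

(* the Jacobi identity for xi and two left-invariant fields *)
Lemma dir_lie_der_comm x y w p : dir (lf x) (b y w) p - dir (lf y) (b x w) p =
  g (lie_der p (br x y)) w - g (br (lie_der p x) y) w - g (br x (lie_der p y)) w.
Proof.
rewrite !dir_lie_der opprD addrACA dir_lfield_comm//; last exact: smooth_triv_dot.
rewrite derive_triv_dot (br_two_step nbr) dot0l subr0 (bracketC nbr y).
by rewrite dotNl /b; ring.
Qed.

(** Both sides are skew in y and w and have the same antisymmetric part in x and y, the left one by
    the Jacobi identity, so Koszul's trick identifies them. The system satisfied by [lie_der] is
    thereby closed. *)
Lemma dir_lie_derE x y w p :
  dir (lf x) (b y w) p = nabla_skew br g (lie_der p) x y w.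
Proof.
pose K x y w := g (lie_der p (br x y)) w - g (br (lie_der p x) y) w
  - g (br x (lie_der p y)) w.
have Tskew a c d : dir (lf a) (b c d) p = - dir (lf a) (b d c) p.
  have -> : b c d = - (b d c).
    by apply/funext => q; rewrite /b lie_der_skew dotC.
  by rewrite /dir deriveN//; apply/diff_derivable/smooth_diff/smooth_lie_der.
rewrite (koszul_unique (T := fun a c d => dir (lf a) (b c d) p) (K := K)) //.
  apply/esym/koszul_unique.
    by move=> *; apply: nabla_skew_antisym => // *; apply: lie_der_skew.
  move=> a c d; apply: nabla_skew_torsion => //.
  exact: lie_der_linear.
by move=> a c d; apply: dir_lie_der_comm.
Qed.

Lemma lie_der_curv p a c y w :
  g (lie_der p (curv a c y)) w + g (lie_der p y) (curv a c w) =
  g (curv (lie_der p a) c y) w + g (curv a (lie_der p c) y) w.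
Proof.
have [t tE] := dot_gaml g nbr y w.
refine (curv_skewB nbr (lie_der_linear p) tE _).
have D2 x c' : dir (lf x) (dir (lf c') (b y w)) p =
  nabla_skew br g (lie_der p) x (gam c' y) w
  + nabla_skew br g (lie_der p) x y (gam c' w)
  - nabla_skew br g (lie_der p) x c' t.
  have -> : dir (lf c') (b y w) =
      fun q => b (gam c' y) w q + b y (gam c' w) q + - b c' t q.
    apply/funext => q; rewrite dir_lie_derE /nabla_skew /b.
    by rewrite -tE.
  rewrite -!dir_lie_derE.
  have d1 := smooth_diff p (smooth_lie_der (gam c' y) w).
  have d2 := smooth_diff p (smooth_lie_der y (gam c' w)).
  have d3 := smooth_diff p (smooth_lie_der c' t).
  rewrite /dir (deriveD (diff_derivable (differentiableD d1 d2))
    (diff_derivable (differentiableN d3))).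
  rewrite (deriveD (diff_derivable d1) (diff_derivable d2)).
  by rewrite (deriveN (diff_derivable d3)).
rewrite -!D2 dir_lfield_comm ?dir_lie_derE//.
exact: smooth_lie_der.
Qed.

Lemma lie_der_ric p x y : ric (lie_der p x) y = ric x (- lie_der p y).
Proof.
apply: ric_skewB => //; first exact: lie_der_skew.
exact: lie_der_curv.
Qed.

Lemma lie_der_center p z : z \in zc -> lie_der p z \in zc.
Proof.
have linN : linear (fun x => - lie_der p x).
  by move=> k u v; rewrite lie_der_linear opprD scalerN.
apply: (center_stable (g := g) nbr (lie_der_linear p) linN) => x y.
  by rewrite lie_der_skew dotNr.
exact: lie_der_ric.
Qed.

Lemma lie_der_vpart p v : v \in vp -> lie_der p v \in vp.
Proof.
move=> vv; apply: orthov_mem => w ww.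
by rewrite lie_der_skew (orthov_dotl vv) ?oppr0// lie_der_center.
Qed.

(** Bracketing kills central components, so x and y may be taken in v. The defect [d] is central,
    and since [lie_der] preserves v at every point, the coefficients [b u d] and [b v d] vanish
    identically; their derivatives drop out of the Jacobi identity tested against [d], leaving
    [g d d = 0]. *)
Lemma lie_der_derivation p x y :
  lie_der p (br x y) = br (lie_der p x) y + br x (lie_der p y).
Proof.
pose pr := orth_proj g zc.
have prc u : pr u \in zc by apply: orth_proj_mem.
have split_br u v : br u v = br (u - pr u) (v - pr v).
  rewrite linearBr linearBl /= (center_brr nbr _ (prc v)).
  by rewrite (center_brl nbr _ (prc u)) !subr0.
have split_der u v : br (lie_der p u) v = br (lie_der p (u - pr u)) (v - pr v).
  rewrite (linear_sub (lie_der_linear p)) linearBr linearBl /=.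
  rewrite (center_brr nbr _ (prc v)).
  rewrite (center_brl nbr _ (lie_der_center p (prc u))).
  by rewrite !subr0.
rewrite [in RHS](bracketC nbr x) split_br split_der [br (lie_der p y) x]split_der.
rewrite -(bracketC nbr).
have := orth_proj_compl g zc x; have := orth_proj_compl g zc y.
rewrite -/(pr x) -/(pr y); move: (x - pr x) (y - pr y) => u v vv uv.
apply/eqP; rewrite -subr_eq0; apply/eqP/(@dot_eq0 _ _ g).
set d := (X in g X X).
have dE : d = lie_der p (br u v) - (br (lie_der p u) v + br u (lie_der p v)).
  by [].
have dc : d \in zc by rewrite rpredB ?rpredD ?br_center// lie_der_center// br_center.
have b0 a q : a \in vp -> b a d q = 0.
  by move=> av; rewrite /b (orthov_dotl (lie_der_vpart q av)).
have d0 a c : c \in vp -> dir (lf a) (b c d) p = 0.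
  move=> cv; have -> : b c d = fun=> 0 by apply/funext => q; apply: b0.
  by rewrite /dir derive_cst.
have := dir_lie_der_comm u v d p; rewrite !d0// subr0 => E.
clearbody d; rewrite {1}dE !dotE; lra.
Qed.

End KillingFields.

(** * Symmetric operators *)

Section SymmetricOperators.
Context {R : realType} {m : nat}.
Local Notation V := 'rV[R]_m.
Context (g : {dot V for @idfun R}).

Lemma quadratic_continuous (A B : V -> V) : linear A -> linear B ->
  continuous (fun x => g (A x) (B x) : R).
Proof.
move=> lA lB; exact: (smooth_bilinear_comp (cbilinear_dot g)
  (smooth_linear lA) (smooth_linear lB) 0%N).
Qed.

Lemma sphere_compact (W : {vspace V}) :
  compact [set x : V | x \in W /\ g x x = 1].
Proof.
have lid : linear (@id V) by [].
have lq : linear (fun x => x - orth_proj g W x).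
  by move=> k u v; rewrite linearP scalerBr opprD addrACA.
apply: bounded_closed_compact.
  (* Boundedness refers to the norm of row vectors, not to [g]; on the sphere Parseval bounds every
     coefficient [g x (e i)] by 1. *)
  exists (\sum_i `|fvec g i|); split; first exact: num_real.
  move=> M /ltW leM x [_ x1]; apply: le_trans leM.
  rewrite [x in `|x|](frame_sum (fvecP g) x).
  apply: (le_trans (ler_norm_sum _ _ _)); apply: ler_sum => i _.
  rewrite normrZ ler_piMl// -(@ler_pXn2r _ 2)// ?nnegrE// expr1n.
  rewrite real_normK ?num_real// -x1 (frame_norm (fvecP g) x) (bigD1 i)//=.
  by rewrite lerDl sumr_ge0// => j _; apply: sqr_ge0.
have -> : [set x : V | x \in W /\ g x x = 1] =
  ((fun x => g (x - orth_proj g W x) (x - orth_proj g W x)) @^-1` [set 0]) `&`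
  ((fun x => g x x) @^-1` [set 1]).
  apply/seteqP; split=> x /= [xW x1]; split=> //.
    by rewrite (@orth_projE _ _ _ _ _ x) ?subrr ?mem0v// dot0l.
  by rewrite -[x](subrK (orth_proj g W x)) (dot_eq0 xW) add0r orth_proj_mem.
apply: closedI; apply: closed_comp.
- by move=> x _; apply: quadratic_continuous.
- exact: closed_eq.
- by move=> x _; apply: (quadratic_continuous lid lid).
- exact: closed_eq.
Qed.

(** The Rayleigh principle: at a maximum [c] of the quadratic form on the unit sphere of [W], the
    form [l * g y y - g (S y) y] is nonnegative on [W] and vanishes at [c], so [c] lies in its
    kernel. *)
Lemma sym_eigenvector (S : V -> V) (W : {vspace V}) : linear S ->
  (forall x y, g (S x) y = g x (S y)) -> (forall x, x \in W -> S x \in W) ->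
  W != 0%VS -> exists l x, [/\ x \in W, x != 0 & S x = l *: x].
Proof.
move=> lS symS SW W0.
have normalize y : y \in W -> y != 0 -> exists2 k, 0 < k &
    let x := k *: y in x \in W /\ g x x = 1.
  move=> yW y0; have gy := dot_gt0 g y0.
  exists (Num.sqrt (g y y))^-1; first by rewrite invr_gt0 sqrtr_gt0.
  split; first by rewrite memvZ.
  by rewrite !dotE mulrA -invfM -expr2 sqr_sqrtr ?ltW// mulVf// gt_eqF.
have A0 : [set x : V | x \in W /\ g x x = 1] !=set0.
  have w0 : vpick W != 0 by rewrite vpick0.
  have [k _ kW] := normalize _ (memv_pick W) w0.
  by eexists; exact: kW.
have lid : linear (@id V) by [].
have [c] := EVT_max_rV A0 (sphere_compact (W := W))
  (continuous_subspaceT (quadratic_continuous lS lid)).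
rewrite inE => -[cW c1] cmax.
set l := g (S c) c in cmax.
have le_l y : y \in W -> 0 <= l * g y y - g (S y) y.
  move=> yW; have [->|y0] := eqVneq y 0; first by rewrite dot0l dot0r mulr0 subrr.
  have [k k0 [kyW ky1]] := normalize _ yW y0.
  have := cmax (k *: y); rewrite inE => /(_ (conj kyW ky1)).
  have SZ : S (k *: y) = k *: S y.
    have S0 : S 0 = 0 by have := lS (-1) 0 0; rewrite scaler0 addr0 scaleN1r addNr.
    by have := lS k y 0; rewrite S0 !addr0.
  rewrite SZ; move: ky1; rewrite !dotE.
  have k20 : 0 < k * k by rewrite mulr_gt0.
  move=> E1 E2; rewrite -(pmulr_rge0 _ k20).
  have -> : k * k * (l * g y y - g (S y) y) =
    l * (k * (k * g y y)) - k * (k * g (S y) y) by ring.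
  by rewrite E1 mulr1 subr_ge0.
exists l, c; split=> //.
  by apply/eqP => c0; move: c1; rewrite c0 dot0l => /esym/eqP; rewrite oner_eq0.
pose d := l *: c - S c.
have dW : d \in W by rewrite rpredB ?rpredZ// SW.
apply/esym/eqP; rewrite -subr_eq0 -/d; apply/eqP/(@dot_eq0 _ _ g).
have D0 := dot_ge0 g d; have Q0 := le_l d dW.
have dE : d = l *: c - S c by [].
clearbody d.
have Ed : g d d = l * g c d - g (S c) d by rewrite {1}dE !dotE.
set D := g d d in D0 Ed *; set Q := l * D - g (S d) d in Q0.
have quad t : 0 <= 2 * t * D + t * t * Q.
  have := le_l (c + t *: d); rewrite rpredD ?rpredZ// => /(_ isT).
  have -> : S (c + t *: d) = S c + t *: S d by rewrite [c + _]addrC lS [LHS]addrC.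
  have cd : g (S d) c = g (S c) d by rewrite symS dotC.
  rewrite !dotE c1 cd -/l -/D (dotC g d c) => H; apply: le_trans H _.
  by rewrite /Q Ed le_eqVlt; apply/orP; left; apply/eqP; ring.
(* With [s = D / (Q + 1)] the inequality reads 0 <= - s^2 (Q + 2), which forces [s = 0]; the 1 keeps
   the denominator positive when [Q] is 0. *)
have := quad (- (D / (Q + 1))).
have Q1 : 0 < Q + 1 by lra.
set s := D / (Q + 1) => H.
have sD : s * (Q + 1) = D by rewrite divfK// gt_eqF.
have s0 : 0 <= s by rewrite divr_ge0// ltW.
suff : s = 0 by move=> s_0; rewrite -sD s_0 mul0r.
nra.
Qed.

End SymmetricOperators.

(** * Parallel tensors *)

Section Irreducible.
Context {R : realType} {m : nat}.
Local Notation V := 'rV[R]_m.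
Context (br : {bilinear V -> V -> V}) (g : {dot V for @idfun R}).
Hypothesis nbr : two_step_nilpotent br.
Hypothesis irr : irreducible_lie br g.
Local Notation zc := (lie_center br).

(** If j(z) = 0, then z is orthogonal to all brackets, so its orthogonal complement is an ideal,
    non-zero since it contains a non-zero bracket; it would split off from the line of z. *)
Lemma adj_center_inj z : z \in zc -> (forall x, adj br g z x = 0) -> z = 0.
Proof.
move=> zz az; apply/eqP/negP => /negP z0; apply: irr.
exists <[z]>%VS, (orthov g <[z]>); split; last exact: orthov_add.
- split=> x y.
    by move=> /vlineP[k ->]; rewrite linearZl_LR /= (center_brl nbr) ?scaler0 ?mem0v.
  by move=> _; rewrite mem_orthov_line dotC -adjE az dot0l.
- split; first by rewrite -dimv_eq0 dim_vline z0.
  have [x [y xy]] := br_nonabelian nbr.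
  apply/eqP => J0; apply: xy; apply/eqP; rewrite -memv0 -J0 mem_orthov_line.
  by rewrite dotC -adjE az dot0l.
- by rewrite orthov_sym.
Qed.

(* The kernel and the image of [Q - mu] are complementary orthogonal ideals. *)
Lemma sym_commute_scalar (Q : V -> V) : linear Q ->
  (forall x y, g (Q x) y = g x (Q y)) ->
  (forall x y, Q (br x y) = br (Q x) y) ->
  exists mu, forall x, Q x = mu *: x.
Proof.
move=> lQ symQ Qbr.
have full0 : (fullv : {vspace V}) != 0%VS.
  have [x [y xy]] := br_nonabelian nbr.
  by apply/eqP => f0; apply: xy; apply/eqP; rewrite -memv0 -f0 memvf.
have [mu [c [_ c0 cE]]] := sym_eigenvector lQ symQ (fun x _ => memvf _) full0.
exists mu.
have lT : linear (fun x => Q x - mu *: x).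
  move=> k u v; rewrite lQ scalerDr opprD addrACA scalerBr !scalerA.
  by rewrite (mulrC mu).
pose TM := GRing.isLinear.Build _ _ _ _ _ lT.
pose T0 : {linear V -> V} := HB.pack (fun x => Q x - mu *: x) TM.
pose T := linfun T0.
have TE x : T x = Q x - mu *: x by rewrite lfunE.
have symT x y : g (T x) y = g x (T y) by rewrite !TE !dotE symQ.
have Tbr x y : T (br x y) = br (T x) y.
  by rewrite !TE Qbr linearBl linearZl_LR.
suff J0 : limg T = 0%VS.
  move=> x; apply/eqP; rewrite -subr_eq0 -TE -memv0 -J0.
  exact/memv_img/memvf.
apply/eqP/negP => /negP J0; apply: irr; exists (lker T), (limg T); split.
- split=> x y.
    by rewrite !memv_ker Tbr => /eqP ->; rewrite linear0l.
  by move=> /memv_imgP[u _ ->]; rewrite -Tbr memv_img// memvf.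
- split=> //; apply/eqP => K0; move: c0.
  by rewrite -memv0 -K0 memv_ker TE cE subrr eqxx.
- apply/subvP => x; rewrite memv_ker => /eqP Tx; apply: orthov_mem => w.
  by move=> /memv_imgP[u _ ->]; rewrite -symT Tx dot0l.
- apply/eqP; rewrite eqEsubv subvf; apply/subvP => x _.
  have : x \in (limg T + orthov g (limg T))%VS by rewrite orthov_add memvf.
  rewrite addvC; apply/subvP/addvS => //; apply/subvP => u uJ.
  rewrite memv_ker; apply/eqP/(@dot_eq0 _ _ g).
  by rewrite symT (orthov_dotl uJ)// memv_img ?memvf.
Qed.

Section Parallel.
Local Notation lf := (lfield br).
Local Notation gam := (gam br g).
Local Notation curv := (curv br g).
Local Notation ric := (ric br g).
Local Notation vp := (vpart br g).
Context (nabla : (V -> V) -> (V -> V) -> V -> V).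
Hypothesis LC : levi_civita (left_metric br g) nabla.
Context (P : V -> V -> V -> R).
Hypothesis symP : sym2_field P.

Lemma sym2_bilinear p : bilinear_for
  (GRing.Scale.Law.clone _ _ *%R _) (GRing.Scale.Law.clone _ _ *%R _) (P p).
Proof.
split=> u k x y; last exact: (sym2_linear symP).
by rewrite !(sym2_sym symP p _ u) (sym2_linear symP).
Qed.

Lemma sym2_linearr p u : linear (P p u : V -> R).
Proof. exact: (sym2_linear symP). Qed.

Lemma sym2_linearl p u : linear (P p ^~ u : V -> R).
Proof. by move=> k x y; apply: (sym2_bilinear p).1. Qed.

Lemma smooth_tensor X Y : smooth X -> smooth Y ->
  smooth (fun p => P p (X p) (Y p)).
Proof.
move=> sX sY.
have -> : (fun p => P p (X p) (Y p)) = fun p => \sum_i X p ord0 i *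
   (\sum_j Y p ord0 j * P p (delta_mx ord0 i) (delta_mx ord0 j)).
  apply/funext => p; rewrite (linear_row _ (sym2_linearl p (Y p))).
  apply: eq_bigr => i _; congr (_ * _).
  by rewrite (linear_row _ (sym2_linearr p _)).
apply: smooth_sum => i; apply: (smooth_bilinear_comp cbilinear_mul).
  exact: smooth_coord.
apply: smooth_sum => j; apply: (smooth_bilinear_comp cbilinear_mul).
  exact: smooth_coord.
exact: (sym2_smooth symP).
Qed.

Let h y w p := P p (lf y p) (lf w p).

Lemma smooth_tensor_lfield y w : smooth (h y w).
Proof. by apply: smooth_tensor; apply: smooth_lfield. Qed.

Hypothesis parP : parallel nabla P.

Lemma dir_parallel x y w p :
  dir (lf x) (h y w) p = h (gam x y) w p + h y (gam x w) p.
Proof.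
have := parP (smooth_lfield br x) (smooth_lfield br y) (smooth_lfield br w) p.
rewrite /cov_deriv !(nabla_lfield nbr LC) -/(h y w) => /eqP.
by rewrite -addrA -opprD subr_eq0 => /eqP.
Qed.

Lemma h_lin p w k x y : h (k *: x + y) w p = k * h x w p + h y w p.
Proof. by rewrite /h lfield_linear (sym2_linearl p). Qed.

Lemma hC p x y : h x y p = h y x p.
Proof. exact: (sym2_sym symP). Qed.

Lemma hB p x y w : h (x - y) w p = h x w p - h y w p.
Proof. by rewrite [x - y]addrC -scaleN1r h_lin mulN1r addrC. Qed.

Lemma hBr p x y w : h w (x - y) p = h w x p - h w y p.
Proof. by rewrite hC hB !(hC p w). Qed.

(** The integrability condition of [dir_parallel], read off from the commutator of two
    left-invariant derivatives. *)
Lemma parallel_curv p a c y w : h (curv a c y) w p + h y (curv a c w) p = 0.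
Proof.
have D2 x c' : dir (lf x) (dir (lf c') (h y w)) p =
    h (gam x (gam c' y)) w p + h (gam c' y) (gam x w) p +
    (h (gam x y) (gam c' w) p + h y (gam x (gam c' w)) p).
  have -> : dir (lf c') (h y w) = fun q => h (gam c' y) w q + h y (gam c' w) q.
    by apply/funext => q; rewrite dir_parallel.
  rewrite -!dir_parallel.
  have d1 := smooth_diff p (smooth_tensor_lfield (gam c' y) w).
  have d2 := smooth_diff p (smooth_tensor_lfield y (gam c' w)).
  by rewrite /dir (deriveD (diff_derivable d1) (diff_derivable d2)).
have := dir_lfield_comm nbr a c p (smooth_tensor_lfield y w).
rewrite !D2 dir_parallel /curv !(hB, hBr); lra.
Qed.

(** The value at the neutral element is enough for later use, since [dir_parallel] expresses the
    first derivatives of [P] there through it. *)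
Lemma parallel_scalar : exists mu, forall u w, P 0 u w = mu * g u w.
Proof.
pose Q p y := \sum_i h y (fvec g i) p *: fvec g i.
have QE p y w : g (Q p y) w = h y w p.
  rewrite /Q dot_suml hC (frame_scalar (fvecP g) (f := fun w => h w y p)).
    by apply: eq_bigr => i _; rewrite dotZl mulrC dotC hC.
  by move=> k u v; apply: h_lin.
have lQ p : linear (Q p).
  move=> k u v; apply: (@dot_inj _ _ g) => w.
  by rewrite dotDl dotZl !QE h_lin.
have symQ p x y : g (Q p x) y = g x (Q p y) by rewrite [RHS]dotC !QE hC.
clearbody Q.
(* [Q p] commutes with every curvature operator, so it can be moved onto the traced vector; pair
   symmetry then makes the trace symmetric in x and y. *)
have ricQ p x y : ric (Q p x) y = ric x (Q p y).
  have E a c : ric a (Q p c) = \sum_i g (curv (fvec g i) a c) (Q p (fvec g i)).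
    apply: eq_bigr => i _; rewrite curv_skew// QE -symQ QE.
    by apply/eqP; rewrite eq_sym -addr_eq0 parallel_curv.
  rewrite ricC// !E.
  under eq_bigr => i _ do rewrite (@curv_pair _ _ br g nbr) (@curvC _ _ br g nbr)
    dotNl (@curv_skew _ _ br g nbr) opprK dotC.
  rewrite (trace_adj (fvecP g) (h := fun u w => g (curv u x y) w)
    _ _ (symQ p)) //.
  - by move=> w; apply: curv_scalar1.
  - by move=> u k v w; rewrite dotDr dotZr.
have Qc p z : z \in zc -> Q p z \in zc.
  by apply: (center_stable (g := g) nbr (lQ p) (lQ p)).
have Qv p v : v \in vp -> Q p v \in vp.
  by apply: (vpart_stable (g := g) nbr (lQ p) (lQ p)).
have Qbrv p x v : x \in vp -> v \in vp -> Q p (br x v) = br x (Q p v).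
  move=> xv vv; apply: (@dot_inj _ _ g) => w.
  pose z := orth_proj g zc w.
  have zz : z \in zc by apply: orth_proj_mem.
  have proj_eq u : u \in zc -> g u w = g u z.
    move=> uc; rewrite -[w](subrK z) dotDr.
    by rewrite (orthov_dotr uc) ?add0r// orth_proj_compl.
  rewrite !proj_eq ?br_center//; last by rewrite Qc// br_center.
  (* [Q] preserves v at every point, so this coefficient is constant. Its zero derivative relates
     [gam x v], half of the bracket, to [gam x z], minus half of j(z)x. *)
  have hvz : h v z = fun=> 0.
    by apply/funext => q; rewrite -QE (orthov_dotl (Qv q v vv)).
  have := dir_parallel x v z p; rewrite hvz /dir derive_cst !gamD.
  rewrite !(adj_vpartl nbr _ xv) (adj_vpartl nbr _ vv) (center_brr nbr _ zz).
  rewrite !subr0 sub0r -QE -(QE p v) dotZr dotNr [g (Q p v) _]dotC adjE.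
  have -> : Q p (2^-1 *: br x v) = 2^-1 *: Q p (br x v).
    have Q0 : Q p 0 = 0 by have := lQ p (-1) 0 0; rewrite scaler0 addr0 scaleN1r addNr.
    by have := lQ p 2^-1 (br x v) 0; rewrite Q0 !addr0.
  by rewrite dotZl (dotC g z); lra.
have Qbr p x y : Q p (br x y) = br (Q p x) y.
  pose pr := orth_proj g zc.
  have prc u : pr u \in zc by apply: orth_proj_mem.
  have brE u v : br u v = br (u - pr u) (v - pr v).
    rewrite linearBr linearBl /= (center_brr nbr _ (prc v)).
    by rewrite (center_brl nbr _ (prc u)) !subr0.
  have -> : br (Q p x) y = br (Q p (x - pr x)) (y - pr y).
    rewrite (linear_sub (lQ p)) linearBr linearBl /=.
    rewrite (center_brr nbr _ (prc y)).
    by rewrite (center_brl nbr _ (Qc p _ (prc x))) !subr0.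
  rewrite brE (bracketC nbr) [RHS](bracketC nbr).
  rewrite -Qbrv ?orth_proj_compl//.
  by rewrite -[- br _ _]sub0r (linear_sub (lQ p)) -(subrr x)
    (linear_sub (lQ p)) subrr sub0r.
have [mu muE] := sym_commute_scalar (lQ 0) (symQ 0) (Qbr 0).
exists mu => u w; rewrite -dotZl -muE QE /h !lfield0.
by [].
Qed.

End Parallel.
End Irreducible.

(** * Eigenspaces on v and the standard Killing fields *)

Section Spectral.
Context {R : realType} {m : nat}.
Local Notation V := 'rV[R]_m.
Context (br : {bilinear V -> V -> V}) (g : {dot V for @idfun R}).
Hypothesis nbr : two_step_nilpotent br.
Local Notation zc := (lie_center br).
Local Notation vp := (vpart br g).

Lemma vpart_inj x y : x \in vp -> y \in vp ->
  (forall v, v \in vp -> g x v = g y v) -> x = y.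
Proof.
move=> xv yv E; apply: (@dot_inj _ _ g) => w.
rewrite -[w](subrKC (orth_proj g zc w)) dotDr [RHS]dotDr.
rewrite !(orthov_dotl _ (orth_proj_mem g zc w))//.
by rewrite E// orth_proj_compl.
Qed.

Lemma adj_proj_l z x : adj br g (orth_proj g zc z) x = adj br g z x.
Proof.
rewrite -[in RHS](subrKC (orth_proj g zc z) z) linearDl /=.
by rewrite (adj_vpartl nbr _ (orth_proj_compl g zc z)) addr0.
Qed.

Lemma adj_proj_r z x : adj br g z (x - orth_proj g zc x) = adj br g z x.
Proof.
by rewrite linearBr /= (adj_centerr g nbr _ (orth_proj_mem g zc x)) subr0.
Qed.

Context (S : 'End(V)) (k : nat) (lambda : 'I_k -> R).
Hypothesis S2v : in_Sym2v br g S.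
Hypothesis lambda_inj : injective lambda.
Hypothesis lambda_range : range lambda = eigenvalues_v br g S.

Lemma S_sym x y : g (S x) y = g x (S y).
Proof. by case: S2v => + _ _; apply. Qed.

Lemma S_vpart x : x \in vp -> S x \in vp.
Proof. by case: S2v => _ /subvP SW _ xv; apply: SW; apply: memv_img. Qed.

Lemma S_center z : z \in zc -> S z = 0.
Proof. by case: S2v => _ _ /subvP zS /zS; rewrite memv_ker => /eqP. Qed.

Local Notation E l := (eigenspace_v br g S l).

Lemma mem_eigenspace_v l x : (x \in E l) = (S x == l *: x) && (x \in vp).
Proof.
rewrite memv_cap; congr (_ && _).
by rewrite memv_ker add_lfunE opp_lfunE scale_lfunE id_lfunE subr_eq0.
Qed.

Lemma eigenspace_v_orth l l' x y : l != l' -> x \in E l -> y \in E l' -> g x y = 0.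
Proof.
rewrite !mem_eigenspace_v => ll' /andP[/eqP Sx _] /andP[/eqP Sy _].
have := S_sym x y; rewrite Sx Sy !dotE => /eqP.
by rewrite -subr_eq0 -mulrBl mulf_eq0 subr_eq0 (negbTE ll') => /eqP.
Qed.

(** The part of v orthogonal to all listed eigenspaces is stable under [S]; were it non-zero, it
    would contain an eigenvector, whose eigenvalue is listed by [lambda_range]. *)
Lemma vpart_eigenspaces x : x \in vp -> x \in (\sum_i E (lambda i))%VS.
Proof.
move=> xv; set U := (\sum_i _)%VS.
have EU i : (E (lambda i) <= U)%VS by apply: sumv_sup (subvv _).
have Uvp u : u \in U -> u \in vp.
  move=> /memv_sumP[f fE ->]; apply: rpred_sum => i _.
  by have := fE i isT; rewrite mem_eigenspace_v => /andP[].
have SU u : u \in U -> S u \in U.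
  move=> /memv_sumP[f fE ->]; rewrite linear_sum; apply: rpred_sum => i _.
  have fi := fE i isT; apply: (subvP (EU i)).
  have SE : S (f i) \in E (lambda i).
    have /andP[/eqP -> _] := etrans (esym (mem_eigenspace_v _ _)) fi.
    by rewrite rpredZ.
  exact: SE.
have W0 : (vp :&: orthov g U)%VS = 0%VS.
  apply/eqP/negP => /negP W0.
  have SW w : w \in (vp :&: orthov g U)%VS -> S w \in (vp :&: orthov g U)%VS.
    rewrite !memv_cap => /andP[wv wU]; rewrite S_vpart//=.
    by apply: orthov_mem => u uU; rewrite S_sym (orthov_dotl wU)// SU.
  have linS : linear S by move=> a u v; rewrite linearP.
  have [l [y [yW y0 Sy]]] := sym_eigenvector linS S_sym SW W0.
  move: yW; rewrite memv_cap => /andP[yv yU].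
  have yE : y \in E l by rewrite mem_eigenspace_v Sy eqxx.
  have : eigenvalues_v br g S l.
    rewrite /eigenvalues_v /=; apply/eqP => El0; move: y0.
    by rewrite -memv0 -El0 yE.
  rewrite -lambda_range => -[i _ il]; rewrite -il in yE.
  have := orthov_dotl yU (subvP (EU i) _ yE) => /dot_eq0 yy.
  by rewrite yy eqxx in y0.
have : x \in (U + orthov g U)%VS by rewrite orthov_add memvf.
move=> /memv_addP[u uU [w wU xE]].
have : w \in (vp :&: orthov g U)%VS.
  rewrite memv_cap wU andbT.
  have -> : w = x - u by rewrite xE addrC addKr.
  by rewrite rpredB// Uvp.
by rewrite W0 memv0 xE => /eqP ->; rewrite addr0.
Qed.

(** By the spectral decomposition the weighted projections add up to [S - a] on v; distinctness of
    the [lambda i] ensures that no eigenspace is counted twice. *)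
Lemma TmapE a z x : x \in vp ->
  Tmap br g S lambda a z x = adj br g z (S x - a *: x).
Proof.
move=> /vpart_eigenspaces/memv_sumP[f fE xE].
rewrite /Tmap jmapE//; congr (adj br g z _).
have projE i : orth_proj g (E (lambda i)) x = f i.
  apply: orth_projE; first exact: fE.
  apply: orthov_mem => w wE.
  rewrite xE (bigD1 i)//= addrAC subrr add0r dot_suml big1// => j ji.
  have lji : lambda j != lambda i by apply: contra ji => /eqP/lambda_inj ->.
  exact: eigenspace_v_orth lji (fE j isT) wE.
under eq_bigr do rewrite projE.
rewrite xE linear_sum scaler_sumr -sumrB; apply: eq_bigr => i _.
have /andP[/eqP Sf _] := etrans (esym (mem_eigenspace_v _ _)) (fE i isT).
by rewrite scalerBl -Sf.
Qed.

End Spectral.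

(** * Right-invariant fields, skew derivations and the metric *)

Section KillingExamples.
Context {R : realType} {m : nat}.
Local Notation V := 'rV[R]_m.
Context (br : {bilinear V -> V -> V}) (g : {dot V for @idfun R}).
Hypothesis nbr : two_step_nilpotent br.
Local Notation lt := (left_triv br).
Local Notation metric := (left_metric br g).

Lemma derive_left_triv (X : V -> V) p w : smooth X ->
  'D_w (fun q => lt q (X q)) p = lt p ('D_w X p) - 2^-1 *: br w (X p).
Proof.
move=> sX; have dX := smooth_diff p sX.
have did : differentiable (@id V) p by apply: ex_diff.
have [db Db] := diff_bilinear_comp (cbilinear_br br) did dX.
have dhb : differentiable (fun q => (- 2^-1) *: br q (X q)) p.
  exact: differentiableZ.
have -> : (fun q => lt q (X q)) = fun q => X q + (- 2^-1) *: br q (X q).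
  by apply/funext => q; rewrite left_trivE// scaleNr.
rewrite (deriveD (diff_derivable dX) (diff_derivable dhb)).
rewrite (deriveZ _ (diff_derivable db)) Db derive_id left_trivE//.
move: ('D_w X p) => D.
by rewrite scalerDr !scaleNr addrA addrAC.
Qed.

Lemma dot_lie_derivative (f h : V -> V) p w a a' lf lh :
  differentiable f p -> differentiable h p ->
  'D_w f p = a + lf -> 'D_w h p = a' + lh -> g lf (h p) = - g (f p) lh ->
  'D_w (fun q => g (f q) (h q)) p - g a (h p) - g (f p) a' = 0.
Proof.
move=> df dh Df Dh E.
rewrite (diff_bilinear_comp (cbilinear_dot g) df dh).2 Df Dh dotDl dotDr E.
ring.
Qed.

(** In the left trivialization the Lie derivative along [xi] is the directional derivative minus the
    pointwise operator [L]; a skew [L] does not contribute to the derivative of the metric. *)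
Lemma killing_field_of_skew (xi : V -> V) (L : V -> V -> V) : smooth xi ->
  (forall p x y, g (L p x) y = - g x (L p y)) ->
  (forall p w, lt p ('D_w xi p) - 2^-1 *: br (xi p) w = L p (lt p w)) ->
  killing_field metric xi.
Proof.
move=> sxi skewL DxiE; split=> // X Y sX sY p.
have dlX := smooth_diff p (smooth_left_triv nbr sX).
have dlY := smooth_diff p (smooth_left_triv nbr sY).
have brE (Z : V -> V) : smooth Z -> 'D_(xi p) (fun q => lt q (Z q)) p =
    lt p (vf_bracket xi Z p) + L p (lt p (Z p)).
  move=> sZ; rewrite derive_left_triv// -DxiE /vf_bracket left_trivB//.
  by rewrite addrA subrK.
exact: dot_lie_derivative dlX dlY (brE X sX) (brE Y sY) (skewL p _ _).
Qed.

(** The right-invariant field with value x at 0. Its flow consists of left translations, which are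
    isometries. *)
Definition rfield (x : V) : V -> V := fun p => x + 2^-1 *: br x p.

Lemma left_triv_rfield x p : lt p (rfield x p) = x + br x p.
Proof.
rewrite left_trivE// /rfield linearDr linearZr_LR /= br_two_stepr//.
rewrite scaler0 addr0 (bracketC nbr p) scalerN opprK -addrA -scalerDl.
have -> : 2^-1 + 2^-1 = 1 :> R by lra.
by rewrite scale1r.
Qed.

Lemma killing_rfield x : killing_field metric (rfield x).
Proof.
have lin : linear (fun p => 2^-1 *: br x p).
  by move=> k u v; rewrite linearPr scalerDr !scalerA mulrC.
apply: (@killing_field_of_skew _ (fun _ _ => 0)) => [|p u v|p w].
- by apply: smoothD; [exact: smooth_cst|exact: smooth_linear].
- by rewrite dot0l dot0r oppr0.
have [dl Dl] := diff_linear p lin.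
rewrite /rfield deriveD; [|exact: derivable_cst|exact: diff_derivable].
rewrite derive_cst add0r Dl left_trivE// linearZr_LR /= br_two_stepr//.
rewrite linearDl linearZl_LR /= (br_two_step nbr) !scaler0 subr0 addr0.
by rewrite subrr.
Qed.

(** In the exponential chart the field p |-> D p generates the isometric automorphisms exp(tD). *)
Lemma killing_derivation (D : 'End(V)) : skew_derivation br g D ->
  killing_field metric D.
Proof.
move=> [der skew].
have lin : linear D by move=> k u v; rewrite linearP.
apply: (@killing_field_of_skew _ (fun _ => D)) => [|p u v|p w].
- exact: smooth_linear.
- exact: skew.
have [_ ->] := diff_linear p lin.
rewrite !left_trivE//.
have -> : D (w - 2^-1 *: br p w) = D w - 2^-1 *: D (br p w).
  by rewrite linearB linearZ.
by rewrite der scalerDr opprD addrA addrAC.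
Qed.

Lemma decomposable_metric_part (nabla : (V -> V) -> (V -> V) -> V -> V) a :
  levi_civita metric nabla ->
  sym2_field (fun p u v => a * metric p u v) /\
  parallel nabla (fun p u v => a * metric p u v).
Proof.
move=> LC; have smooth_metric X Y : smooth X -> smooth Y ->
    smooth (fun p => metric p (X p) (Y p)).
  move=> sX sY; exact: (smooth_bilinear_comp (cbilinear_dot g)
    (smooth_left_triv nbr sX) (smooth_left_triv nbr sY)).
have scalar_dot (l : V -> V) u : linear l -> scalar (fun v => a * g u (l v)).
  by move=> ll k x y; rewrite ll !dotE; ring.
split.
  split=> [p u|p u v|u v].
  - exact: scalar_dot (left_triv_linear nbr p).
  - exact: (congr1 (fun r => a * r) (dotC g _ _)).
  - apply: (smooth_bilinear_comp cbilinear_mul); first exact: smooth_cst.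
    by apply: smooth_metric; apply: smooth_cst.
move=> X Y Z sX sY sZ p; rewrite /cov_deriv.
have -> : dir X (fun q => a * metric q (Y q) (Z q)) p =
    a * dir X (fun q => metric q (Y q) (Z q)) p.
  have d1 := smooth_diff p (smooth_metric _ _ sY sZ).
  have d2 : differentiable (fun _ : V => a) p by apply: differentiable_cst.
  have [_ D] := diff_bilinear_comp cbilinear_mul d2 d1.
  by rewrite /dir D derive_cst mul0r add0r.
have cancel (d x y : R) : d = x + y -> a * d - a * x - a * y = 0.
  by move=> ->; ring.
exact: cancel (lc_metric LC sX sY sZ p).
Qed.

End KillingExamples.

(** * Decomposable tensors *)

Section Decomposability.
Context {R : realType} {m : nat}.
Local Notation V := 'rV[R]_m.
Context (br : {bilinear V -> V -> V}) (g : {dot V for @idfun R}).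
Hypothesis nbr : two_step_nilpotent br.
Hypothesis irr : irreducible_lie br g.
Local Notation zc := (lie_center br).
Local Notation vp := (vpart br g).
Local Notation adj := (adj br g).
Local Notation lt := (left_triv br).
Local Notation lf := (lfield br).
Local Notation gam := (gam br g).
Local Notation metric := (left_metric br g).
Context (nabla : (V -> V) -> (V -> V) -> V -> V).
Hypothesis LC : levi_civita metric nabla.
Context (S : 'End(V)) (k : nat) (lambda : 'I_k -> R).
Hypothesis S2v : in_Sym2v br g S.
Hypothesis lambda_inj : injective lambda.
Hypothesis lambda_range : range lambda = eigenvalues_v br g S.

Lemma skew_derivation_of_decomposition P (r : nat) (c : 'I_r -> R)
    (xi eta : 'I_r -> V -> V) mu z :
  sym2_field P -> parallel nabla P ->
  (forall u w, P 0 u w = mu * g u w) ->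
  (forall i, killing_field metric (xi i) /\ killing_field metric (eta i)) ->
  (forall p u v, left_tensor br g S p u v =
    P p u v + \sum_(i < r) c i * sym_prod metric (xi i) (eta i) p u v) ->
  z \in zc -> extends_to_skew_derivation br g (Tmap br g S lambda mu z).
Proof.
move=> symP parP Pmu kil dec zz.
have kxi i := (kil i).1; have keta i := (kil i).2.
pose F i p := lt p (xi i p); pose G i p := lt p (eta i p).
pose B i := lie_der br (xi i) 0; pose C i := lie_der br (eta i) 0.
have decE u w : (fun q => P q (lf u q) (lf w q) +
    \sum_i c i * (g (F i q) u * g (G i q) w + g (G i q) u * g (F i q) w)) =
    fun=> g (S u) w.
  apply/funext => q; have := dec q (lf u q) (lf w q).
  rewrite /left_tensor /left_inv !left_triv_lfield// => ->; congr (_ + _).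
  apply: eq_bigr => i _; rewrite /sym_prod /left_metric /left_inv.
  by rewrite !left_triv_lfield.
have dFdot i w p : differentiable (fun q => g (F i q) w) p.
  exact/smooth_diff/smooth_triv_dot/kxi.
have dGdot i w p : differentiable (fun q => g (G i q) w) p.
  exact/smooth_diff/smooth_triv_dot/keta.
have DF i x w : 'D_(lf x 0) (fun q => g (F i q) w) 0 =
    g (B i x) w - g (br x (F i 0)) w.
  exact: (derive_triv_dot nbr (kxi i)).
have DG i x w : 'D_(lf x 0) (fun q => g (G i q) w) 0 =
    g (C i x) w - g (br x (G i 0)) w.
  exact: (derive_triv_dot nbr (keta i)).
have linB i : linear (B i) by apply: lie_der_linear.
have linC i : linear (C i) by apply: lie_der_linear.
have skewB i x y : g (B i x) y = - g x (B i y) by apply: lie_der_skew.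
have skewC i x y : g (C i x) y = - g x (C i y) by apply: lie_der_skew.
have Bvp i x : x \in vp -> B i x \in vp by apply: (lie_der_vpart nbr (kxi i)).
have Cvp i x : x \in vp -> C i x \in vp by apply: (lie_der_vpart nbr (keta i)).
have Bder i x y : B i (br x y) = br (B i x) y + br x (B i y).
  exact: (lie_der_derivation nbr (kxi i)).
have Cder i x y : C i (br x y) = br (C i x) y + br x (C i y).
  exact: (lie_der_derivation nbr (keta i)).
clearbody F G B C.
have dec0 u w : g (S u) w = mu * g u w +
    \sum_i c i * (g (F i 0) u * g (G i 0) w + g (G i 0) u * g (F i 0) w).
  by have /(congr1 (fun f => f 0)) <- := decE u w; rewrite /= Pmu !lfield0.
have dec1 x u w : \sum_i c i *
    ((g (B i x) u - g (br x (F i 0)) u) * g (G i 0) w +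
     g (F i 0) u * (g (C i x) w - g (br x (G i 0)) w) +
     ((g (C i x) u - g (br x (G i 0)) u) * g (F i 0) w +
     g (G i 0) u * (g (B i x) w - g (br x (F i 0)) w))) = 0.
  pose t i q := c i * (g (F i q) u * g (G i q) w + g (G i q) u * g (F i q) w).
  have dFG i := diff_bilinear_comp cbilinear_mul (dFdot i u 0) (dGdot i w 0).
  have dGF i := diff_bilinear_comp cbilinear_mul (dGdot i u 0) (dFdot i w 0).
  have dcst i : differentiable (fun _ : V => c i) 0 by apply: differentiable_cst.
  have dt i := diff_bilinear_comp cbilinear_mul (dcst i)
    (differentiableD (dFG i).1 (dGF i).1).
  have dh := smooth_diff 0 (smooth_tensor_lfield br symP u w).
  have := congr1 (fun f => 'D_(lf x 0) f 0) (decE u w).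
  have dsum := diff_sum (fun i => (dt i).1).
  rewrite /= derive_cst (deriveD (diff_derivable dh) (diff_derivable dsum.1)).
  (* At 0 the parallel part is a multiple of [g], for which [gam x] is skew. *)
  have -> : 'D_(lf x 0) (fun p => P p (lf u p) (lf w p)) 0 = 0.
    apply: etrans (dir_parallel nbr LC parP x u w 0) _.
    by rewrite !Pmu !lfield0 (gam_skew g nbr) (dotC g u); ring.
  rewrite add0r dsum.2 => E; rewrite -[RHS]E; apply: eq_bigr => i _.
  rewrite (dt i).2 derive_cst mul0r add0r; congr (_ * _).
  rewrite (deriveD (diff_derivable (dFG i).1) (diff_derivable (dGF i).1)).
  by rewrite (dFG i).2 (dGF i).2 (DF i x u) (DG i x w) (DG i x u) (DF i x w).
(* The weights are those with which [B i x] and [C i x], paired with a vector of v, occur in [dec1]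
   when its last argument is z. They do not depend on x, so skewness and the derivation rule are
   inherited. *)
pose M x := \sum_i c i *: (g (G i 0) z *: B i x + g (F i 0) z *: C i x).
have linM : linear M.
  move=> a u v; rewrite /M scaler_sumr -big_split /=; apply: eq_bigr => i _.
  rewrite linB linC.
  by apply: (@dot_inj _ _ g) => w; rewrite !dotE; ring.
have skewM x y : g (M x) y = - g x (M y).
  rewrite /M dot_suml dot_sumr -sumrN; apply: eq_bigr => i _.
  by rewrite !dotE skewB skewC; ring.
have derM x y : M (br x y) = br (M x) y + br x (M y).
  rewrite /M linear_sumlz linear_sumr -big_split /=; apply: eq_bigr => i _.
  rewrite Bder Cder linearZl_LR linearZr_LR /= !(linearDl, linearDr) /=.
  rewrite !linearZl_LR !linearZr_LR /=.
  by apply: (@dot_inj _ _ g) => w; rewrite !dotE; ring.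
have Mvp x : x \in vp -> M x \in vp.
  move=> xv; apply: rpred_sum => i _; rewrite rpredZ// rpredD// rpredZ//.
    exact: Bvp.
  exact: Cvp.
(* The terms of [dec1] at (v, z) that survive besides [M] contain j(z) applied to the values of the
   fields at 0; by [dec0] these recombine into [S v - mu *: v]. This describes the transpose of [M],
   and skewness gives [M] itself. *)
have key x v : x \in vp -> v \in vp ->
    g (M x) v = g z (br x (S v - mu *: v)).
  move=> xv vv.
  have brz y w : g (br y w) v = 0.
    by rewrite (orthov_dotr (br_center nbr y w) vv).
  have Bz i y : y \in vp -> g (B i y) z = 0.
    by move=> yv; rewrite (orthov_dotl (Bvp i y yv)).
  have Cz i y : y \in vp -> g (C i y) z = 0.
    by move=> yv; rewrite (orthov_dotl (Cvp i y yv)).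
  have SE : S v - mu *: v =
      \sum_i c i *: (g (F i 0) v *: G i 0 + g (G i 0) v *: F i 0).
    apply: (@dot_inj _ _ g) => w; rewrite !dotE dec0 addrAC subrr add0r.
    by rewrite dot_suml; apply: eq_bigr => i _; rewrite !dotE.
  rewrite SE linear_sumr dot_sumr /M dot_suml.
  apply/eqP; rewrite -subr_eq0 -sumrB; apply/eqP.
  apply: etrans (dec1 x v z); apply: eq_bigr => i _.
  rewrite linearZr_LR /= linearDr /= !linearZr_LR /= !brz Bz// Cz// !dotE.
  by rewrite ![g z (br _ _)]dotC; ring.
pose MM := GRing.isLinear.Build _ _ _ _ _ linM.
pose ML : {linear V -> V} := HB.pack M MM.
exists (linfun ML); split.
  by split=> x y; rewrite !lfunE /= ?derM ?skewM.
move=> x xv; rewrite lfunE /= TmapE//.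
apply: (vpart_inj (g := g) (Mvp x xv) (@adj_vpart _ _ br g nbr _ _)) => v vv.
by rewrite skewM dotC key// adjE (bracketC nbr v) dotNr opprK.
Qed.

End Decomposability.

(** * From derivations to a decomposition, and conversely *)

Section Decomposition.
Context {R : realType} {m : nat}.
Local Notation V := 'rV[R]_m.
Context (br : {bilinear V -> V -> V}) (g : {dot V for @idfun R}).
Hypothesis nbr : two_step_nilpotent br.
Hypothesis irr : irreducible_lie br g.
Local Notation zc := (lie_center br).
Local Notation vp := (vpart br g).
Local Notation adj := (adj br g).
Local Notation e := (fvec g).
Local Notation pr := (orth_proj g zc).

Section DerivationFamily.
Context (A : V -> V).
Hypothesis linA : linear A.
Hypothesis symA : forall x y, g (A x) y = g x (A y).
Hypothesis Avp : forall x, x \in vp -> A x \in vp.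
Hypothesis Azc : forall z, z \in zc -> A z \in zc.
Context (Dm : V -> V -> V).
Hypothesis linDm : forall u, linear (Dm u).
Hypothesis skewDm : forall u x y, g (Dm u x) y = - g x (Dm u y).
Hypothesis derDm : forall u x y,
  Dm u (br x y) = br (Dm u x) y + br x (Dm u y).
Hypothesis Dm_vp : forall u x, x \in vp -> Dm u x = adj u (A x).

Lemma derivation_center u z : z \in zc -> Dm u z \in zc.
Proof.
move=> zz; apply/(lie_centerP _ nbr) => x.
have := derDm u z x; rewrite !(center_brl nbr _ zz) addr0 => <-.
by have := linDm u (-1) 0 0; rewrite scaler0 addr0 scaleN1r addNr.
Qed.

(** On v the product of the skew [adj u] and the symmetric [A] is the skew [Dm u], and such a
    product is skew only if the factors commute. *)
Lemma adj_A_commute u x : adj u (A x) = A (adj u x).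
Proof.
have main v : v \in vp -> adj u (A v) = A (adj u v).
  move=> vv; apply: (vpart_inj (g := g)).
  - exact: adj_vpart.
  - exact/Avp/adj_vpart.
  move=> w ww; rewrite -Dm_vp// skewDm Dm_vp// symA.
  by rewrite [RHS]adj_skew.
have prx : pr x \in zc by apply: orth_proj_mem.
rewrite -[RHS](congr1 A (adj_proj_r g nbr u x)) -main ?orth_proj_compl//.
by rewrite (linear_sub linA) linearBr /= (adj_centerr g nbr _ (Azc prx)) subr0.
Qed.

(** The derivation rule transposed: j(Dz) = [D, j(z)]. *)
Lemma adj_derivation u z x : adj (Dm u z) x = Dm u (adj z x) - adj z (Dm u x).
Proof.
apply: (@dot_inj _ _ g) => w; rewrite dotDl dotNl !adjE (skewDm u (adj z x)).
by rewrite adjE skewDm derDm dotDr; ring.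
Qed.

(** On v, j sends the two summands to A[j(u), j(w)] and A[j(w), j(u)], which cancel; j is injective
    on the centre. *)
Lemma derivation_center_antisym u w : Dm u (pr w) + Dm w (pr u) = 0.
Proof.
have prc x : pr x \in zc by apply: orth_proj_mem.
apply: (adj_center_inj nbr irr).
  by rewrite rpredD// derivation_center.
move=> x; rewrite -(adj_proj_r g nbr _ x); set v := x - pr x.
have vv : v \in vp by apply: orth_proj_compl.
clearbody v; rewrite linearDl /= !adj_derivation !(Dm_vp _ vv).
rewrite !Dm_vp ?adj_vpart// !adj_proj_l// !adj_A_commute.
by rewrite addrA subrK subrr.
Qed.

(** Both sides are compared as polynomials in p. The linear terms of the first product cancel
    against [A (adj u p)] inside [Dm u p], its quadratic term against the two halves of the bracket
    terms, and the terms in [pr p] by antisymmetry. *)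
Lemma decomposition_identity p u w :
  g (A u) w = g (A (u - adj u p)) (w - adj w p) +
   (g (Dm u p - 2^-1 *: br p (Dm u p)) w + g (Dm w p - 2^-1 *: br p (Dm w p)) u).
Proof.
have prp : pr p \in zc by apply: orth_proj_mem.
have DmD x y z : Dm x (y + z) = Dm x y + Dm x z.
  by have := linDm x 1 y z; rewrite !scale1r.
have split_pr y : y = y - pr y + pr y by rewrite subrK.
have DpE x : Dm x p = A (adj x p) + Dm x (pr p).
  rewrite {1}(split_pr p) DmD.
  by rewrite Dm_vp ?orth_proj_compl// adj_A_commute adj_proj_r.
have Dpz x y : g (Dm x p) y = g (A (adj x p)) y - g (pr p) (Dm x (pr y)).
  rewrite DpE dotDl skewDm {2}(split_pr y) DmD dotDr (orthov_dotr prp) ?add0r//.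
  by rewrite Dm_vp ?orth_proj_compl// adj_vpart.
have brD x y : g (br p (Dm x p)) y = g (adj y p) (A (adj x p)).
  rewrite dotC -adjE DpE dotDr [X in _ + X](orthov_dotl (adj_vpart _ _ _ _)) ?addr0//.
  exact: derivation_center.
have anti := congr1 (g (pr p)) (derivation_center_antisym u w).
rewrite dotDr dot0r in anti.
rewrite !dotE !Dpz !brD (linear_sub linA) !dotE.
have h1 : g (A u) (adj w p) = g (A (adj w p)) u by rewrite symA dotC.
have h2 := dotC g (adj w p) (A (adj u p)).
have h3 := symA (adj u p) (adj w p).
lra.
Qed.

End DerivationFamily.

Local Notation lt := (left_triv br).
Local Notation metric := (left_metric br g).
Context (nabla : (V -> V) -> (V -> V) -> V -> V).
Hypothesis LC : levi_civita metric nabla.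
Context (S : 'End(V)) (k : nat) (lambda : 'I_k -> R).
Hypothesis S2v : in_Sym2v br g S.
Hypothesis lambda_inj : injective lambda.
Hypothesis lambda_range : range lambda = eigenvalues_v br g S.

Lemma dot_rfield x p u : g (x + br x p) u = g x (u - adj u p).
Proof.
rewrite dotDl dotDr dotNr (dotC g x (adj u p)) adjE (bracketC nbr x) dotNl.
by rewrite [g (br p x) u]dotC.
Qed.

Lemma sum_rfield (A : V -> V) p u w : linear A ->
  (forall x y, g (A x) y = g x (A y)) ->
  \sum_i 2^-1 * (g (e i + br (e i) p) u * g (A (e i) + br (A (e i)) p) w +
    g (A (e i) + br (A (e i)) p) u * g (e i + br (e i) p) w) =
  g (A (u - adj u p)) (w - adj w p).
Proof.
move=> linA symA; have E x y :
    \sum_i g (e i) x * g (A (e i)) y = g (A x) y.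
  rewrite (frame_scalar (fvecP g) (f := fun x => g (A x) y)).
    by apply: eq_bigr => i _; rewrite [g x _]dotC.
  by move=> c x' y'; rewrite linA !dotE.
rewrite -mulr_sumr big_split /=.
under eq_bigr do rewrite !dot_rfield.
under [X in _ + X]eq_bigr do rewrite !dot_rfield mulrC.
rewrite !E (symA (w - _)) (dotC g (w - _)); lra.
Qed.

Lemma decomposable_of_derivations a :
  (forall z, z \in zc ->
    extends_to_skew_derivation br g (Tmap br g S lambda a z)) ->
  decomposable metric nabla (left_tensor br g S).
Proof.
move=> ext; pose A x := S x - a *: x.
have linA : linear A.
  move=> c u v; rewrite /A linearP scalerDr opprD addrACA scalerBr !scalerA.
  by rewrite (mulrC c).
have symA x y : g (A x) y = g x (A y) by rewrite /A !dotE (S_sym S2v).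
have Avp x : x \in vp -> A x \in vp.
  by move=> xv; rewrite rpredB ?rpredZ// (S_vpart S2v).
have Azc z : z \in zc -> A z \in zc.
  by move=> zz; rewrite /A (S_center S2v zz) sub0r rpredN rpredZ.
have prc x : pr x \in zc by apply: orth_proj_mem.
have [D DP] := choice (fun i => ext (pr (e i)) (prc (e i))).
(* The extensions are chosen for the projected frame only and interpolated linearly in u, so the
   choice itself need not be linear in z. *)
pose Dm u x := \sum_i g u (pr (e i)) *: D i x.
have linDm u : linear (Dm u).
  move=> c x y; rewrite /Dm scaler_sumr -big_split /=; apply: eq_bigr => i _.
  by rewrite linearP scalerDr !scalerA mulrC.
have skewDm u x y : g (Dm u x) y = - g x (Dm u y).
  rewrite /Dm dot_suml dot_sumr -sumrN; apply: eq_bigr => i _.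
  by rewrite !dotE (DP i).1.2 mulrN.
have derDm u x y : Dm u (br x y) = br (Dm u x) y + br x (Dm u y).
  rewrite /Dm linear_sumlz linear_sumr -big_split /=; apply: eq_bigr => i _.
  by rewrite (DP i).1.1 linearZl_LR linearZr_LR /= scalerDr.
have Dm_vp u x : x \in vp -> Dm u x = adj u (A x).
  move=> xv; apply: (@dot_inj _ _ g) => w; rewrite /Dm dot_suml adjE.
  have prK : pr (br (A x) w) = br (A x) w.
    by apply: orth_projE; rewrite ?subrr ?mem0v// br_center.
  rewrite -prK -orth_proj_adj (dot_frame g (pr u)); apply: eq_bigr => i _.
  rewrite dotZl (DP i).2// TmapE// adjE orth_proj_adj; congr (_ * _).
    by rewrite orth_proj_adj.
  by rewrite -/(A x) prK dotC.
have ident := decomposition_identity linA symA Avp Azc linDm skewDm derDm Dm_vp.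
have [symP parP] := decomposable_metric_part nbr a LC.
pose n := fdim g.
exists (fun p u v => a * metric p u v), (n + n)%N.
exists (fun i : 'I_(n + n) => match fintype.split i with inl _ => 2^-1 | inr _ => 1 end).
exists (fun i : 'I_(n + n) => match fintype.split i with
  inl j => rfield br (e j) | inr j => rfield br (pr (e j)) end).
exists (fun i : 'I_(n + n) => match fintype.split i with
  inl j => rfield br (A (e j)) | inr j => D j : V -> V end).
split=> //.
  move=> i; case: (fintype.split i) => j; split; try exact: killing_rfield.
  exact: killing_derivation (DP j).1.
move=> p u0 w0; rewrite big_split_ord /=.
have E1 i : sym_prod metric (rfield br (e i)) (rfield br (A (e i))) p u0 w0 =
    g (e i + br (e i) p) (lt p u0) * g (A (e i) + br (A (e i)) p) (lt p w0) +
    g (A (e i) + br (A (e i)) p) (lt p u0) * g (e i + br (e i) p) (lt p w0).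
  by rewrite /sym_prod /left_metric /left_inv !left_triv_rfield.
(* A right-invariant field with a central value is also left-invariant, hence constant in the left
   trivialization. *)
have E2 i : sym_prod metric (rfield br (pr (e i))) (D i) p u0 w0 =
    g (pr (e i)) (lt p u0) * g (D i p - 2^-1 *: br p (D i p)) (lt p w0) +
    g (D i p - 2^-1 *: br p (D i p)) (lt p u0) * g (pr (e i)) (lt p w0).
  rewrite /sym_prod /left_metric /left_inv left_triv_rfield//.
  by rewrite (center_brl nbr _ (prc _)) addr0 (left_trivE nbr p (D i p)).
pose K1 u w := \sum_i 2^-1 * (g (e i + br (e i) p) u *
    g (A (e i) + br (A (e i)) p) w +
  g (A (e i) + br (A (e i)) p) u * g (e i + br (e i) p) w).
pose K2 u w := \sum_i (g (pr (e i)) u * g (D i p - 2^-1 *: br p (D i p)) w +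
  g (D i p - 2^-1 *: br p (D i p)) u * g (pr (e i)) w).
have final u w : g (S u) w = a * g u w + (K1 u w + K2 u w).
  have E3 x y : \sum_i g (pr (e i)) x * g (D i p - 2^-1 *: br p (D i p)) y =
      g (Dm x p - 2^-1 *: br p (Dm x p)) y.
    rewrite dotDl dotNl dotZl [g (br _ _) _]dotC -adjE.
    rewrite {1}/Dm dot_suml /Dm dot_sumr mulr_sumr -sumrB; apply: eq_bigr => i _.
    by rewrite !dotE (dotC g (br p _)) -adjE [g (pr _) x]dotC; ring.
  have -> : g (S u) w = a * g u w + g (A u) w by rewrite /A !dotE; ring.
  rewrite (ident p u w) /K1 sum_rfield//; congr (_ + (_ + _)).
  rewrite /K2 big_split /= E3; congr (_ + _).
  by rewrite -E3; apply: eq_bigr => i _; rewrite mulrC.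
apply: etrans (final (lt p u0) (lt p w0)) _; congr (_ + (_ + _)).
  by apply: eq_bigr => i _; rewrite (unsplitK (inl i)) E1.
by apply: eq_bigr => i _; rewrite (unsplitK (inr i)) E2 mul1r.
Qed.

Lemma derivations_of_decomposable :
  decomposable metric nabla (left_tensor br g S) ->
  exists a, forall z, z \in zc ->
    extends_to_skew_derivation br g (Tmap br g S lambda a z).
Proof.
move=> [P [r [c [xi [eta [symP parP kil dec]]]]]].
have [mu Pmu] := parallel_scalar nbr irr LC symP parP.
by exists mu => z; apply: (skew_derivation_of_decomposition nbr LC S2v
  lambda_inj lambda_range symP parP Pmu kil dec).
Qed.

End Decomposition.

Theorem theorem5p10 (R : realType) (m : nat)
    (br : {bilinear 'rV[R]_m -> 'rV[R]_m -> 'rV[R]_m})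
    (g : {dot 'rV[R]_m for @idfun R})
    (nabla : ('rV[R]_m -> 'rV[R]_m) -> ('rV[R]_m -> 'rV[R]_m) ->
             'rV[R]_m -> 'rV[R]_m)
    (S : 'End('rV[R]_m)) (k : nat) (lambda : 'I_k -> R) :
  two_step_nilpotent br ->
  irreducible_lie br g ->
  levi_civita (left_metric br g) nabla ->
  in_Sym2v br g S ->
  killing_tensor nabla (left_tensor br g S) ->
  injective lambda ->
  range lambda = eigenvalues_v br g S ->
  decomposable (left_metric br g) nabla (left_tensor br g S) <->
  exists a : R, forall z, z \in lie_center br ->
    extends_to_skew_derivation br g (Tmap br g S lambda a z).
Proof.
move=> nbr irr LC S2v _ lambda_inj lambda_range; split.
  exact: (derivations_of_decomposable nbr irr LC S2v lambda_inj lambda_range).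
by move=> [a ext];
  apply: (decomposable_of_derivations nbr irr LC S2v lambda_inj lambda_range ext).
Qed.
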